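(* In PI, if $P\sim_g Q$ then $P\sigma\sim_g Q\sigma$ for every substitution $\sigma$.
   Context: PI is the finite, sum-free $\pi$-calculus over an infinite set of names: prefixes $\pi::=m(x)\mid\overline m\langle n\rangle$ and processes $P::=\mathbf 0\mid\pi.P\mid P_1|P_2\mid(\nu p)P$; $m(x)$ binds $x$ and $(\nu p)$ binds $p$; $\mathrm{fn}(P)$ denotes free names; processes are taken up to $\alpha$-conversion and satisfy the convention that bound names are pairwise distinct and distinct from free names. Substitutions $\sigma$ map names to names and are applied capture-avoidingly; $P[n/x]$ replaces $x$ by $n$. Late transitions $P\xrightarrow{\mu}P'$ with labels $\mu::=a(x)\mid\overline a\langle b\rangle\mid\overline a(p)\mid\tau$ (bound names: $x$ in $a(x)$, $p$ in $\overline a(p)$) are given by: $\pi.P\xrightarrow{\pi}P$; if $P\xrightarrow{a(x)}P'$ and $Q\xrightarrow{\overline a\langle b\rangle}Q'$ then $P|Q\xrightarrow{\tau}P'[b/x]|Q'$; if $P\xrightarrow{\overline a\langle b\rangle}P'$ and $a\neq b$ then $(\nu b)P\xrightarrow{\overline a(b)}P'$; if $P\xrightarrow{a(x)}P'$ and $Q\xrightarrow{\overline a(p)}Q'$ then $P|Q\xrightarrow{\tau}(\nu p)(P'[p/x]|Q')$; if $P\xrightarrow{\mu}P'$ and the bound names of $\mu$ are not free in $Q$ then $P|Q\xrightarrow{\mu}P'|Q$; if $P\xrightarrow{\mu}P'$ and $p$ is not a free name of $\mu$ then $(\nu p)P\xrightarrow{\mu}(\nu p)P'$; plus the symmetric versions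 of the rules involving $|$. A ground bisimulation is a symmetric relation $\mathcal R$ such that $P\mathcal RQ$ and $P\xrightarrow{\mu}P'$ imply $Q\xrightarrow{\mu}Q'$ with $P'\mathcal RQ'$ for some $Q'$; ground bisimilarity $\sim_g$ is the union of all ground bisimulations. *)

(* Defs.v *)
(** Processes of PI up to alpha-conversion, in de Bruijn notation.

    The names are the natural numbers.  A binder ([Inp], [New]) binds the index
    [0] of its body, and the name [n] of the context is the index [S n] there.
    Syntactic equality is thus alpha-equivalence, and bound names are always
    fresh. *)

Definition name := nat.

Inductive proc : Type :=
| Nil : proc
| Inp : name -> proc -> proc            (* m(x).P, where x is the index 0 of P *)
| Out : name -> name -> proc -> proc
| Par : proc -> proc -> proc
| New : proc -> proc.                   (* (nu p)P, where p is the index 0 of P *)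

(** The substitution [s], moved under a binder. *)
Definition up (s : name -> name) (n : name) : name :=
  match n with
  | 0 => 0
  | S m => S (s m)
  end.

Fixpoint subst (s : name -> name) (P : proc) : proc :=
  match P with
  | Nil => Nil
  | Inp m P1 => Inp (s m) (subst (up s) P1)
  | Out m n P1 => Out (s m) (s n) (subst s P1)
  | Par P1 P2 => Par (subst s P1) (subst s P2)
  | New P1 => New (subst (up s) P1)
  end.

(** [subst (inst b) P] is P[b/x], for x the index 0 of [P], which goes out of
    scope. *)
Definition inst (b : name) (n : name) : name :=
  match n with
  | 0 => b
  | S m => m
  end.

(** Weakening: [subst S P] is [P] seen in the scope of one more (fresh) name. *)
Notation shift := (subst S).

(** Exchange of the two innermost names. *)
Definition swap (n : name) : name :=
  match n with
  | 0 => 1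
  | 1 => 0
  | _ => n
  end.

(** The bound name of a label a(x) or a bound output is not written in the
    label: it is the index [0] of the target of the transition, where the other
    names are shifted by one. *)
Inductive label : Type :=
| LInp : name -> label                  (* a(x) *)
| LOut : name -> name -> label          (* free output of b on a *)
| LBOut : name -> label                 (* bound output of p on a *)
| LTau : label.

Definition binds (mu : label) : bool :=
  match mu with
  | LInp _ | LBOut _ => true
  | LOut _ _ | LTau => false
  end.

Definition subst_label (s : name -> name) (mu : label) : label :=
  match mu with
  | LInp a => LInp (s a)
  | LOut a b => LOut (s a) (s b)
  | LBOut a => LBOut (s a)
  | LTau => LTau
  end.

(** [weaken_by mu Q] is [Q] in the scope of the bound name of [mu], if any. *)
Definition weaken_by (mu : label) (Q : proc) : proc :=
  if binds mu then shift Q else Q.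

(** In [step_new], the label of the premise has the form [subst_label S mu]
    exactly when the restricted name is not free in it.  If [mu] binds a name,
    that name is the index 0 and the restricted one the index 1 in the target of
    the premise, whereas the restriction of the conclusion is the innermost
    binder; hence the exchange. *)
Definition exchange_by (mu : label) (P : proc) : proc :=
  if binds mu then subst swap P else P.

Inductive step : proc -> label -> proc -> Prop :=
| step_inp : forall (a : name) (P : proc),
    step (Inp a P) (LInp a) P
| step_out : forall (a b : name) (P : proc),
    step (Out a b P) (LOut a b) P
| step_comm_l : forall (a b : name) (P P' Q Q' : proc),
    step P (LInp a) P' -> step Q (LOut a b) Q' ->
    step (Par P Q) LTau (Par (subst (inst b) P') Q')
| step_comm_r : forall (a b : name) (P P' Q Q' : proc),
    step P (LOut a b) P' -> step Q (LInp a) Q' ->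
    step (Par P Q) LTau (Par P' (subst (inst b) Q'))
| step_open : forall (a : name) (P P' : proc),
    step P (LOut (S a) 0) P' ->
    step (New P) (LBOut a) P'
| step_close_l : forall (a : name) (P P' Q Q' : proc),
    step P (LInp a) P' -> step Q (LBOut a) Q' ->
    step (Par P Q) LTau (New (Par P' Q'))
| step_close_r : forall (a : name) (P P' Q Q' : proc),
    step P (LBOut a) P' -> step Q (LInp a) Q' ->
    step (Par P Q) LTau (New (Par P' Q'))
| step_par_l : forall (mu : label) (P P' Q : proc),
    step P mu P' ->
    step (Par P Q) mu (Par P' (weaken_by mu Q))
| step_par_r : forall (mu : label) (P Q Q' : proc),
    step Q mu Q' ->
    step (Par P Q) mu (Par (weaken_by mu P) Q')
| step_new : forall (mu : label) (P P' : proc),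
    step P (subst_label S mu) P' ->
    step (New P) mu (New (exchange_by mu P')).

(** The bound name of [mu], if any, is the same name in [P'] and [Q'], fresh for
    [P] and [Q]; it is not instantiated. *)
Definition ground_bisimulation (R : proc -> proc -> Prop) : Prop :=
  (forall P Q : proc, R P Q -> R Q P) /\
  (forall (P Q : proc) (mu : label) (P' : proc),
      R P Q -> step P mu P' ->
      exists Q' : proc, step Q mu Q' /\ R P' Q').

Definition ground_bisimilar (P Q : proc) : Prop :=
  exists R : proc -> proc -> Prop, ground_bisimulation R /\ R P Q.

(* Main.v *)
(** A substitution [s] creates a new silent step only when it identifies the
    subjects [a] and [b] of an input and an output that occur in parallel in [P].
    Then [P] performs these two actions in both orders, with the same residual
    up to renaming, and so does any [Q] ground bisimilar to [P].  In [Q], either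
    the two actions of one of these runs are again in parallel, and [Q] under
    [s] makes the matching silent step, or both runs are nested: an [a]-prefix
    with continuation [F] where [F] does [b] to [F'], and a [b]-prefix with
    continuation [G] where [G] does [a] to [G'], such that [a.F | G'] and
    [F' | b.G] are bisimilar.  This mutual desynchronisation is impossible, as
    one sees after erasing all but the free inputs on [a] and outputs on [b].
    What remains are forests of prefixes with interleaving parallel composition,
    which satisfy unique decomposition into primes: every prime factor of [a.F]
    starts with [a] only and every prime factor of [b.G] with [b] only, so [a.F]
    would divide [F'], which is smaller. *)

Require Import Defs.
From Stdlib Require Import List Permutation Arith Lia Classical.
Import ListNotations.

(** * Forests of prefixes *)

Inductive tree (A : Type) : Type :=
| Node : A -> list (tree A) -> tree A.
Arguments Node {A}.

Fixpoint tsize {A} (t : tree A) : nat :=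
  match t with
  | Node _ F => S (list_sum (map tsize F))
  end.

Definition fsize {A} (F : list (tree A)) : nat := list_sum (map tsize F).

(** A forest stands for the parallel composition of its trees: a move consumes a root and releases
    its children. The permutations make the order in the lists irrelevant. *)
Definition fstep {A} (F : list (tree A)) (a : A) (F' : list (tree A)) : Prop :=
  exists S F0, Permutation F (Node a S :: F0) /\ Permutation F' (S ++ F0).

Definition fbisimulation {A} (R : list (tree A) -> list (tree A) -> Prop) : Prop :=
  (forall F G, R F G -> R G F) /\
  (forall F G a F', R F G -> fstep F a F' -> exists G', fstep G a G' /\ R F' G').

Definition fbisim {A} (F G : list (tree A)) : Prop :=
  exists R, fbisimulation R /\ R F G.

Lemma fsize_app {A} (F G : list (tree A)) : fsize (F ++ G) = fsize F + fsize G.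
Proof. unfold fsize. now rewrite map_app, list_sum_app. Qed.

Lemma fsize_perm {A} (F G : list (tree A)) : Permutation F G -> fsize F = fsize G.
Proof. induction 1; unfold fsize in *; simpl; lia. Qed.

Lemma fsize_nil_iff {A} (F : list (tree A)) : fsize F = 0 <-> F = [].
Proof.
  split; [|now intros ->].
  destruct F as [|[a S] F]; [easy|discriminate].
Qed.

Lemma fstep_head {A} (a : A) S F : fstep (Node a S :: F) a (S ++ F).
Proof. exists S, F. split; reflexivity. Qed.

Lemma fstep_size {A} (F F' : list (tree A)) a : fstep F a F' -> fsize F = S (fsize F').
Proof.
  intros (T & F0 & H1 & H2). apply fsize_perm in H1, H2.
  rewrite H1, H2, fsize_app. reflexivity.
Qed.

Lemma fstep_perm {A} (F G F' G' : list (tree A)) a :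
  Permutation F G -> Permutation F' G' -> fstep F a F' -> fstep G a G'.
Proof.
  intros HF HF' (S & F0 & H1 & H2). exists S, F0. split.
  - now rewrite <- HF.
  - now rewrite <- HF'.
Qed.

Lemma fstep_app_l {A} (F F' G : list (tree A)) a :
  fstep F a F' -> fstep (F ++ G) a (F' ++ G).
Proof.
  intros (S & F0 & H1 & H2). exists S, (F0 ++ G). split.
  - now rewrite H1.
  - now rewrite H2, app_assoc.
Qed.

Lemma fstep_app_r {A} (F G G' : list (tree A)) a :
  fstep G a G' -> fstep (F ++ G) a (F ++ G').
Proof.
  intros H. apply (fstep_app_l _ _ F) in H.
  eapply fstep_perm; [| |exact H]; apply Permutation_app_comm.
Qed.

Lemma fstep_app_inv {A} (F G H : list (tree A)) a :
  fstep (F ++ G) a H ->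
  (exists F', fstep F a F' /\ Permutation H (F' ++ G)) \/
  (exists G', fstep G a G' /\ Permutation H (F ++ G')).
Proof.
  intros (S & F0 & H1 & H2).
  assert (Hin : In (Node a S) (F ++ G)).
  { eapply Permutation_in; [symmetry; exact H1|now left]. }
  apply in_app_or in Hin as [Hin|Hin]; apply in_split in Hin as (l1 & l2 & ->).
  - left. exists (S ++ l1 ++ l2). split.
    + exists S, (l1 ++ l2). split; [symmetry; apply Permutation_middle|reflexivity].
    + rewrite H2, <- app_assoc. apply Permutation_app_head.
      rewrite <- !app_assoc in H1. simpl in H1.
      rewrite <- Permutation_middle in H1. apply Permutation_cons_inv in H1.
      now rewrite <- H1, app_assoc.
  - right. exists (S ++ l1 ++ l2). split.
    + exists S, (l1 ++ l2). split; [symmetry; apply Permutation_middle|reflexivity].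
    + rewrite H2, (Permutation_app_comm F), <- app_assoc. apply Permutation_app_head.
      rewrite app_assoc, <- Permutation_middle in H1. apply Permutation_cons_inv in H1.
      now rewrite <- H1, (Permutation_app_comm _ F), app_assoc.
Qed.

Lemma fbisim_fbisimulation {A} : fbisimulation (@fbisim A).
Proof.
  split.
  - intros F G (R & HR & H). exists R. split; [exact HR|]. now apply HR.
  - intros F G a F' (R & HR & H) Hs. destruct (proj2 HR _ _ _ _ H Hs) as (G' & ? & ?).
    exists G'. split; [assumption|]. now exists R.
Qed.

Lemma fbisim_sym {A} (F G : list (tree A)) : fbisim F G -> fbisim G F.
Proof. apply fbisim_fbisimulation. Qed.

Lemma fbisim_step {A} (F G F' : list (tree A)) a :
  fbisim F G -> fstep F a F' -> exists G', fstep G a G' /\ fbisim F' G'.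
Proof. apply fbisim_fbisimulation. Qed.

Lemma fbisim_perm {A} (F G : list (tree A)) : Permutation F G -> fbisim F G.
Proof.
  intros H. exists (@Permutation _). split; [split|exact H].
  - now symmetry.
  - intros F1 G1 a F' HP Hs. exists F'. split; [|reflexivity].
    eapply fstep_perm; [exact HP|reflexivity|exact Hs].
Qed.

Lemma fbisim_trans {A} (F G H : list (tree A)) : fbisim F G -> fbisim G H -> fbisim F H.
Proof.
  intros H1 H2. exists (fun F H => exists G, fbisim F G /\ fbisim G H).
  split; [split|eauto].
  - intros F0 H0 (G0 & ? & ?). exists G0. split; now apply fbisim_sym.
  - intros F0 H0 a F' (G0 & HFG & HGH) Hs.
    destruct (fbisim_step _ _ _ _ HFG Hs) as (G' & Hs' & ?).
    destruct (fbisim_step _ _ _ _ HGH Hs') as (H' & ? & ?). eauto.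
Qed.

Lemma fbisim_app {A} (F1 F2 G1 G2 : list (tree A)) :
  fbisim F1 G1 -> fbisim F2 G2 -> fbisim (F1 ++ F2) (G1 ++ G2).
Proof.
  intros H1 H2.
  exists (fun F G => exists F1 F2 G1 G2, Permutation F (F1 ++ F2) /\
    Permutation G (G1 ++ G2) /\ fbisim F1 G1 /\ fbisim F2 G2).
  split; [split|exists F1, F2, G1, G2; repeat split; auto].
  - intros F G (A1 & A2 & B1 & B2 & ? & ? & ? & ?).
    exists B1, B2, A1, A2. repeat split; auto using fbisim_sym.
  - intros F G a F' (A1 & A2 & B1 & B2 & HF & HG & HA & HB) Hs.
    apply (fstep_perm _ (A1 ++ A2) _ F') in Hs; [|exact HF|reflexivity].
    apply fstep_app_inv in Hs as [(A' & Hs & HP)|(A' & Hs & HP)].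
    + destruct (fbisim_step _ _ _ _ HA Hs) as (B' & HsB & HB'). exists (B' ++ B2). split.
      * eapply fstep_perm; [symmetry; exact HG|reflexivity|now apply fstep_app_l].
      * exists A', A2, B', B2. repeat split; auto.
    + destruct (fbisim_step _ _ _ _ HB Hs) as (B' & HsB & HB'). exists (B1 ++ B'). split.
      * eapply fstep_perm; [symmetry; exact HG|reflexivity|now apply fstep_app_r].
      * exists A1, A', B1, B'. repeat split; auto.
Qed.

(** Each move removes exactly one node and a nonempty forest can always move, so the size is the
    length of every maximal run. *)
Lemma fbisim_size {A} (F G : list (tree A)) : fbisim F G -> fsize F = fsize G.
Proof.
  remember (fsize F) as n eqn:En. revert F G En.
  induction n as [|n IH]; intros F G En H.
  - symmetry in En. apply fsize_nil_iff in En as ->.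
    destruct G as [|[a S] G]; [easy|].
    destruct (fbisim_step _ _ _ _ (fbisim_sym _ _ H) (fstep_head a S G)) as (F' & Hs & _).
    apply fstep_size in Hs. discriminate.
  - destruct F as [|[a S] F]; [discriminate|].
    pose proof (fstep_head a S F) as Hs.
    destruct (fbisim_step _ _ _ _ H Hs) as (G' & Hs' & H').
    apply fstep_size in Hs, Hs'. rewrite Hs', <- (IH (S ++ F) G' ltac:(lia) H'). reflexivity.
Qed.

(* If [X'] is matched against a move of the common factor, that factor replays the
   same move on the left, and the match is against a smaller common factor. *)
Lemma fbisim_cancel_step {A} (X' Y R R0 R' : list (tree A)) c
  (cancel : forall Y' Q Q', fstep Y c Y' -> fbisim Q Q' ->
     fbisim (X' ++ Q) (Y' ++ Q') -> fbisim X' Y') :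
  fbisim (X' ++ R) (Y ++ R') -> fstep R c R0 -> fbisim R0 R' ->
  exists Y', fstep Y c Y' /\ fbisim X' Y'.
Proof.
  remember (fsize R) as n eqn:En. revert R R0 R' En.
  induction n as [|n IH]; intros R R0 R' En H Hs HR.
  - apply fstep_size in Hs. lia.
  - pose proof (fstep_size _ _ _ Hs) as Hsz.
    destruct (fbisim_step _ _ _ _ H (fstep_app_r X' _ _ _ Hs)) as (Z & HsZ & HZ).
    apply fstep_app_inv in HsZ as [(Y' & HsY & HP)|(R'' & HsR & HP)].
    + exists Y'. split; [exact HsY|]. apply (cancel Y' R0 R'); auto.
      eapply fbisim_trans; [exact HZ|now apply fbisim_perm].
    + destruct (fbisim_step _ _ _ _ (fbisim_sym _ _ HR) HsR) as (R1 & HsR1 & HR1).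
      apply (IH R0 R1 R''); auto using fbisim_sym; [lia|].
      eapply fbisim_trans; [exact HZ|now apply fbisim_perm].
Qed.

Lemma fbisim_cancel {A} (X Y R R' : list (tree A)) :
  fbisim (X ++ R) (Y ++ R') -> fbisim R R' -> fbisim X Y.
Proof.
  remember (fsize X) as n eqn:En. revert X Y R R' En.
  induction n as [n IHn] using lt_wf_ind; intros X Y R R' -> H HR.
  (* The size bound makes every residual strictly smaller than [X], so the induction hypothesis
     places it in the first disjunct. The bound passes to the symmetric pair because bisimilar
     forests have equal size. *)
  exists (fun X1 Y1 => fbisim X1 Y1 \/ ((fsize X1 <= fsize X) /\
     exists R R', fbisim R R' /\ fbisim (X1 ++ R) (Y1 ++ R'))).
  split; [split|right; eauto].
  - intros X1 Y1 [HX|(Hle & Q & Q' & HQ & HX)]; [left; now apply fbisim_sym|right].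
    split.
    + apply fbisim_size in HX, HQ. rewrite !fsize_app in HX. lia.
    + exists Q', Q. split; now apply fbisim_sym.
  - intros X1 Y1 c X1' [HX|(Hle & Q & Q' & HQ & HX)] Hs.
    + destruct (fbisim_step _ _ _ _ HX Hs) as (? & ? & ?). eauto.
    + pose proof (fstep_size _ _ _ Hs) as Hsz.
      destruct (fbisim_step _ _ _ _ HX (fstep_app_l _ _ Q _ Hs)) as (Z & HsZ & HZ).
      apply fstep_app_inv in HsZ as [(Y' & HsY & HP)|(Q'' & HsQ & HP)].
      * exists Y'. split; [exact HsY|left]. apply (IHn (fsize X1') ltac:(lia) X1' Y' Q Q'); auto.
        eapply fbisim_trans; [exact HZ|now apply fbisim_perm].
      (* The answer came from the context [Q'] and not from [Y1]; a move of [Y1] is recovered by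
         letting [Q] imitate that answer. *)
      * destruct (fbisim_step _ _ _ _ (fbisim_sym _ _ HQ) HsQ) as (Q0 & HsQ0 & HQ0).
        destruct (fbisim_cancel_step X1' Y1 Q Q0 Q'' c) as (Y' & HsY & HY'); auto using fbisim_sym.
        -- intros Y' P P' _ HP' HX'. apply (IHn (fsize X1') ltac:(lia) X1' Y' P P'); auto.
        -- eapply fbisim_trans; [exact HZ|now apply fbisim_perm].
        -- eauto.
Qed.

(** * Unique decomposition into primes *)

(** Indecomposability is up to bisimilarity. A prime is a single tree, but not conversely: two
    nested [a] are bisimilar to two parallel [a]. *)
Definition prime {A} (X : list (tree A)) : Prop :=
  X <> [] /\ forall F G, fbisim X (F ++ G) -> F = [] \/ G = [].

Lemma prime_decomposition {A} (F : list (tree A)) :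
  exists M, Forall prime M /\ fbisim F (concat M).
Proof.
  remember (fsize F) as n eqn:En. revert F En.
  induction n as [n IHn] using lt_wf_ind; intros F ->.
  destruct (classic (F = [])) as [->|Hne].
  { exists []. split; [constructor|now apply fbisim_perm]. }
  destruct (classic (prime F)) as [HF|HF].
  { exists [F]. split; [now constructor|]. simpl. rewrite app_nil_r. now apply fbisim_perm. }
  assert (exists F1 F2, fbisim F (F1 ++ F2) /\ F1 <> [] /\ F2 <> []) as (F1 & F2 & H & H1 & H2).
  { apply NNPP. intros Hc. apply HF. split; [exact Hne|]. intros F1 F2 H.
    apply NNPP. intros Hn. apply Hc. exists F1, F2. tauto. }
  pose proof (fbisim_size _ _ H) as Hsz. rewrite fsize_app in Hsz.
  rewrite <- fsize_nil_iff in H1, H2.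
  destruct (IHn (fsize F1) ltac:(lia) F1 eq_refl) as (M1 & ? & ?).
  destruct (IHn (fsize F2) ltac:(lia) F2 eq_refl) as (M2 & ? & ?).
  exists (M1 ++ M2). split; [apply Forall_app; auto|].
  rewrite concat_app. eapply fbisim_trans; [exact H|now apply fbisim_app].
Qed.

Lemma concat_middle_perm {T} (X : list T) M1 M2 :
  Permutation (concat (M1 ++ X :: M2)) (X ++ concat (M1 ++ M2)).
Proof. rewrite !concat_app. simpl. apply Permutation_app_swap_app. Qed.

Lemma fstep_concat_inv {A} (M : list (list (tree A))) a H :
  fstep (concat M) a H ->
  exists M1 X M2 X', M = M1 ++ X :: M2 /\ fstep X a X' /\ Permutation H (X' ++ concat (M1 ++ M2)).
Proof.
  revert H. induction M as [|Y M IH]; simpl; intros H Hs.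
  - apply fstep_size in Hs. discriminate.
  - apply fstep_app_inv in Hs as [(Y' & Hs & HP)|(K & Hs & HP)].
    + exists [], Y, M, Y'. auto.
    + destruct (IH _ Hs) as (M1 & X & M2 & X' & -> & HX & HK).
      exists (Y :: M1), X, M2, X'. repeat split; auto. simpl.
      rewrite HP, HK. apply Permutation_app_swap_app.
Qed.

Lemma argmax {T} (f : T -> nat) (l : list T) :
  l <> [] -> exists x, In x l /\ forall y, In y l -> f y <= f x.
Proof.
  induction l as [|x l IH]; [easy|intros _].
  destruct l as [|y l].
  - exists x. split; [now left|]. intros y [->|[]]. lia.
  - destruct IH as (z & Hz & Hmax); [discriminate|].
    destruct (le_lt_dec (f x) (f z)).
    + exists z. split; [now right|]. intros w [->|Hw]; auto.
    + exists x. split; [now left|]. intros w [->|Hw]; [lia|].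
      specialize (Hmax w Hw). lia.
Qed.

Lemma fsize_In_concat {A} (X : list (tree A)) M : In X M -> fsize X <= fsize (concat M).
Proof.
  intros (M1 & M2 & ->)%in_split. rewrite (fsize_perm _ _ (concat_middle_perm X M1 M2)), fsize_app. lia.
Qed.

Lemma In_middle {T} (x y : T) l1 l2 : In x (l1 ++ y :: l2) <-> x = y \/ In x (l1 ++ l2).
Proof. rewrite !in_app_iff. simpl. intuition congruence. Qed.

Lemma Forall_middle {T} (P : T -> Prop) x l1 l2 :
  Forall P (l1 ++ x :: l2) <-> P x /\ Forall P (l1 ++ l2).
Proof.
  rewrite !Forall_forall. split.
  - intros H. split; [apply H; apply In_middle; auto|]. intros y Hy. apply H, In_middle; auto.
  - intros [Hx H] y [->|Hy]%In_middle; auto.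
Qed.

(* With no common prime, a prime [X] of maximal size survives any move of another
   factor of its own side, but no move of the other side can leave or create a copy of it. *)
Lemma no_maximal_prime {A} (M N : list (list (tree A))) X
  (IH : forall M' N' : list (list (tree A)), fsize (concat M') < fsize (concat M) ->
     Forall prime M' -> Forall prime N' -> fbisim (concat M') (concat N') ->
     forall X, In X M' -> exists Y, In Y N' /\ fbisim X Y) :
  Forall prime M -> Forall prime N -> fbisim (concat M) (concat N) ->
  ~ (exists X Y, In X M /\ In Y N /\ fbisim X Y) ->
  In X M -> (forall Y, In Y N -> fsize Y <= fsize X) -> False.
Proof.
  intros HM HN H Hdisj (M1 & M2 & ->)%in_split Hmax.
  pose proof (proj1 (Forall_middle _ _ _ _) HM) as [HX HM12].
  pose proof (concat_middle_perm X M1 M2) as HP.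
  destruct (M1 ++ M2) as [|Z M'] eqn:EM.
  (* If [X] is alone on its side, its primality makes the other side reduce to one factor, which is
     then a common prime. *)
  - assert (HXN : fbisim X (concat N)).
    { eapply fbisim_trans; [|exact H]. apply fbisim_perm. symmetry. now rewrite app_nil_r in HP. }
    destruct N as [|Y N].
    + apply HX. apply fsize_nil_iff. now rewrite (fbisim_size _ _ HXN).
    + destruct (proj2 HX Y (concat N) HXN) as [->|E].
      * now apply Forall_inv in HN as [HN _].
      * simpl in HXN. rewrite E, app_nil_r in HXN. apply Hdisj. exists X, Y.
        split; [apply In_middle; auto|]. split; [now left|exact HXN].
  (* Otherwise a root of another factor moves. [X] is still a factor of the residual, so by
     induction it has a counterpart among the primes of the matching residual. *)
  - pose proof (Forall_inv HM12) as HZ. pose proof (Forall_inv_tail HM12) as HM'.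
    destruct Z as [|[a S] Z]; [now destruct HZ|].
    assert (Hs : fstep (concat (M1 ++ X :: M2)) a (X ++ (S ++ Z) ++ concat M')).
    { eapply fstep_perm; [symmetry; exact HP|reflexivity|]. apply fstep_app_r.
      simpl. apply (fstep_app_l (Node a S :: Z)). apply fstep_head. }
    destruct (fbisim_step _ _ _ _ H Hs) as (G & HsG & HG).
    apply fstep_concat_inv in HsG as (N1 & Y & N2 & Y' & -> & HsY & HPG).
    destruct (prime_decomposition (S ++ Z)) as (L & HL & HSL).
    destruct (prime_decomposition Y') as (K & HK & HYK).
    pose proof (proj1 (Forall_middle _ _ _ _) HN) as [HY HN12].
    assert (Hb : fbisim (concat (X :: L ++ M')) (concat (K ++ N1 ++ N2))).
    { simpl. rewrite concat_app, (concat_app K). eapply fbisim_trans; [|eapply fbisim_trans; [exact HG|]].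
      - apply fbisim_app; [now apply fbisim_perm|]. apply fbisim_app; [now apply fbisim_sym|now apply fbisim_perm].
      - eapply fbisim_trans; [apply fbisim_perm; exact HPG|].
        apply fbisim_app; [exact HYK|now apply fbisim_perm]. }
    destruct (IH (X :: L ++ M') (K ++ N1 ++ N2)) with (X := X) as (Y0 & HY0 & HXY0); auto.
    + apply fstep_size in Hs. rewrite Hs. simpl. rewrite concat_app, !fsize_app.
      apply fbisim_size in HSL. rewrite fsize_app in HSL. lia.
    + constructor; [exact HX|]. apply Forall_app; auto.
    + apply Forall_app; auto.
    + now left.
    + apply in_app_or in HY0 as [HY0|HY0].
      (* A counterpart inside [Y'] is smaller than [Y], hence smaller than [X]. *)
      * apply fsize_In_concat in HY0. apply fbisim_size in HXY0, HYK. apply fstep_size in HsY.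
        specialize (Hmax Y ltac:(apply In_middle; auto)). lia.
      * apply Hdisj. exists X, Y0. split; [apply In_middle; auto|]. split; [apply In_middle; auto|exact HXY0].
Qed.

(** A common prime is cancelled on both sides and the induction goes on; without one, a prime of
    maximal size among both sides is contradictory. Multiplicities, left out of the statement, are
    recovered by repeated cancellation. *)
Lemma prime_unique {A} (M N : list (list (tree A))) :
  Forall prime M -> Forall prime N -> fbisim (concat M) (concat N) ->
  forall X, In X M -> exists Y, In Y N /\ fbisim X Y.
Proof.
  remember (fsize (concat M)) as n eqn:En. revert M N En.
  induction n as [n IHn] using lt_wf_ind; intros M N -> HM HN H X HX.
  assert (IH : forall M' N' : list (list (tree A)), fsize (concat M') < fsize (concat M) ->
     Forall prime M' -> Forall prime N' -> fbisim (concat M') (concat N') ->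
     forall X, In X M' -> exists Y, In Y N' /\ fbisim X Y).
  { intros M' N' Hlt. eapply IHn; [exact Hlt|reflexivity]. }
  destruct (classic (exists X Y, In X M /\ In Y N /\ fbisim X Y)) as [(X0 & Y0 & HX0 & HY0 & H0)|Hdisj].
  - apply in_split in HX0 as (M1 & M2 & ->). apply in_split in HY0 as (N1 & N2 & ->).
    apply In_middle in HX as [->|HX].
    { exists Y0. split; [apply In_middle; auto|exact H0]. }
    apply Forall_middle in HM as [HX0 HM]. apply Forall_middle in HN as [_ HN].
    destruct (IH (M1 ++ M2) (N1 ++ N2)) with (X := X) as (Y & HY & HXY); auto.
    + rewrite (fsize_perm _ _ (concat_middle_perm X0 M1 M2)), fsize_app.
      destruct HX0 as [HX0 _]. rewrite <- fsize_nil_iff in HX0. lia.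
    + eapply fbisim_cancel; [|exact H0].
      eapply fbisim_trans; [|eapply fbisim_trans; [exact H|]]; apply fbisim_perm.
      * rewrite concat_middle_perm. apply Permutation_app_comm.
      * rewrite concat_middle_perm. apply Permutation_app_comm.
    + exists Y. split; [apply In_middle; auto|exact HXY].
  - exfalso. destruct (argmax fsize (M ++ N)) as (Z & HZ & Hmax).
    { destruct M; [easy|discriminate]. }
    apply in_app_or in HZ as [HZ|HZ].
    + apply (no_maximal_prime M N Z); auto. intros; apply Hmax, in_or_app; auto.
    + apply (no_maximal_prime N M Z); auto using fbisim_sym.
      * now rewrite <- (fbisim_size _ _ H).
      * intros (X1 & Y1 & ? & ? & ?). apply Hdisj. exists Y1, X1. auto using fbisim_sym.
      * intros; apply Hmax, in_or_app; auto.
Qed.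

(** Each prime of [M] has a counterpart on the other side, which cannot lie in [L]. It is cancelled
    against this counterpart in [N], until [M] is used up. *)
Lemma coprime_factor_size {A} (M K N L : list (list (tree A))) :
  Forall prime M -> Forall prime K -> Forall prime N -> Forall prime L ->
  (forall X Y, In X M -> In Y L -> ~ fbisim X Y) ->
  fbisim (concat (M ++ K)) (concat (N ++ L)) -> fsize (concat M) <= fsize (concat N).
Proof.
  revert N. induction M as [|X M IH]; intros N HM HK HN HL Hdisj H; [apply Nat.le_0_l|].
  inversion HM as [|? ? HX HM']; subst.
  destruct (prime_unique ((X :: M) ++ K) (N ++ L)) with (X := X) as (Y & HY & HXY); auto.
  - apply Forall_app; auto.
  - apply Forall_app; auto.
  - now left.
  - apply in_app_or in HY as [HY|HY].
    2:{ exfalso. apply (Hdisj X Y); auto. now left. }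
    apply in_split in HY as (N1 & N2 & ->).
    apply Forall_middle in HN as [HY HN].
    rewrite (fsize_perm _ _ (concat_middle_perm Y N1 N2)). simpl. rewrite !fsize_app.
    rewrite (fbisim_size _ _ HXY). apply Nat.add_le_mono_l. apply IH; auto.
    + intros X1 Y1 ? ?. apply Hdisj; auto. now right.
    + eapply fbisim_cancel; [|exact HXY].
      eapply fbisim_trans; [|eapply fbisim_trans; [exact H|]]; apply fbisim_perm.
      * simpl. apply Permutation_app_comm.
      * rewrite <- !app_assoc. simpl. rewrite concat_middle_perm. apply Permutation_app_comm.
Qed.

(** * Impossibility of mutual desynchronisation *)

Lemma factor_initials {A} (M : list (list (tree A))) a S X b X' :
  fbisim [Node a S] (concat M) -> In X M -> fstep X b X' -> a = b.
Proof.
  intros H (M1 & M2 & ->)%in_split Hs.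
  assert (Hs' : fstep (concat (M1 ++ X :: M2)) b (X' ++ concat (M1 ++ M2))).
  { eapply fstep_perm; [symmetry; apply concat_middle_perm|reflexivity|]. now apply fstep_app_l. }
  (* A move of a factor is a move of the whole, hence matched by [[Node a S]], whose only root is
     [a]. *)
  destruct (fbisim_step _ _ _ _ (fbisim_sym _ _ H) Hs') as (F & (T & F0 & HP & _) & _).
  apply Permutation_length_1_inv in HP. congruence.
Qed.

(* A prime factor of [a.S] starts with [a] only and one of [b.T] with [b] only, so all
   of [a.S] must be found in [S'], which is too small. *)
Lemma no_mutual_desynchronisation {A} (a b : A) S S' T T' :
  a <> b -> fstep S b S' -> fstep T a T' ->
  ~ fbisim (Node a S :: T') (S' ++ [Node b T]).
Proof.
  intros Hab HS HT H.
  destruct (prime_decomposition [Node a S]) as (M & HM & HSM).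
  destruct (prime_decomposition T') as (K & HK & HTK).
  destruct (prime_decomposition S') as (N & HN & HSN).
  destruct (prime_decomposition [Node b T]) as (L & HL & HTL).
  assert (fsize (concat M) <= fsize (concat N)) as Hle.
  { apply (coprime_factor_size M K N L); auto.
    - intros X Y HX HY HXY.
      destruct X as [|[c U] X].
      + rewrite Forall_forall in HM. now destruct (HM _ HX).
      + pose proof (fstep_head c U X) as Hs.
        destruct (fbisim_step _ _ _ _ HXY Hs) as (Y' & HsY & _).
        apply Hab. rewrite (factor_initials _ _ _ _ _ _ HSM HX Hs).
        symmetry. eapply factor_initials; eassumption.
    - rewrite !concat_app.
      eapply fbisim_trans; [|eapply fbisim_trans; [exact H|now apply fbisim_app]].
      apply fbisim_sym. now apply (fbisim_app [Node a S]). }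
  (* [S'] has two nodes fewer than [[Node a S]]: the root [a] and the consumed [b]. *)
  apply fbisim_size in HSM, HSN. apply fstep_size in HS.
  rewrite <- HSM, <- HSN in Hle. unfold fsize in *. simpl in Hle. lia.
Qed.

(** Since [a <> b], the two chosen roots are different trees of [X]. The other trees are common to
    both residuals, and cancelling them leaves a mutual desynchronisation. *)
Lemma not_desynchronised_both_ways {A} (a b : A) X S S' F T T' G :
  a <> b ->
  Permutation X (Node a S :: F) -> fstep S b S' ->
  Permutation X (Node b T :: G) -> fstep T a T' ->
  ~ fbisim (S' ++ F) (T' ++ G).
Proof.
  intros Hab HF HS HG HT H.
  rewrite HF in HG.
  assert (Hin : In (Node b T) F).
  { destruct (Permutation_in (Node b T) (Permutation_sym HG)) as [E|Hin];
      [now left|congruence|exact Hin]. }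
  apply in_split in Hin as (l1 & l2 & ->).
  assert (HG' : Permutation G (Node a S :: l1 ++ l2)).
  { apply Permutation_cons_inv with (a := Node b T). rewrite <- HG.
    rewrite <- Permutation_middle. apply perm_swap. }
  apply (no_mutual_desynchronisation a b S S' T T' Hab HS HT).
  apply (fbisim_cancel _ _ (l1 ++ l2) (l1 ++ l2)); [|now apply fbisim_perm].
  apply fbisim_sym in H.
  eapply fbisim_trans; [|eapply fbisim_trans; [exact H|]]; apply fbisim_perm.
  - rewrite HG'. simpl. apply (Permutation_middle T' (l1 ++ l2)).
  - rewrite <- Permutation_middle, <- app_assoc. reflexivity.
Qed.

(** * Renamings *)

Lemma up_ext s t : (forall n, s n = t n) -> forall n, up s n = up t n.
Proof. intros H [|n]; simpl; congruence. Qed.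

Lemma subst_ext s t P : (forall n, s n = t n) -> subst s P = subst t P.
Proof. revert s t. induction P; intros s t H; simpl; f_equal; auto using up_ext. Qed.

Lemma subst_comp s t P : subst s (subst t P) = subst (fun n => s (t n)) P.
Proof.
  revert s t. induction P; intros s t; simpl; f_equal; auto.
  all: rewrite IHP; apply subst_ext; now intros [|k].
Qed.

Lemma subst_id s P : (forall n, s n = n) -> subst s P = P.
Proof.
  revert s. induction P; intros s H; simpl; f_equal; auto.
  all: apply IHP; intros [|k]; simpl; auto.
Qed.

Definition upb (mu : label) (s : name -> name) : name -> name :=
  if binds mu then up s else s.

(** [wk] and [exch] express [weaken_by] and [exchange_by] as plain substitutions, so that equalities
    between targets of transitions reduce to pointwise equalities of renamings. *)
Definition wk (mu : label) : name -> name := if binds mu then S else fun n => n.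

Definition exch (mu : label) : name -> name := if binds mu then swap else fun n => n.

Lemma weaken_byE mu Q : weaken_by mu Q = subst (wk mu) Q.
Proof. unfold weaken_by, wk. destruct (binds mu); [reflexivity|]. now rewrite subst_id. Qed.

Lemma exchange_byE mu Q : exchange_by mu Q = subst (exch mu) Q.
Proof. unfold exchange_by, exch. destruct (binds mu); [reflexivity|]. now rewrite subst_id. Qed.

Lemma binds_subst s mu : binds (subst_label s mu) = binds mu.
Proof. now destruct mu. Qed.

(** Both sides become one substitution applied to the same process. The composites single out at
    most the three innermost indices, so a case split of that depth settles their equality. *)
Ltac rename_by_cases :=
  repeat (progress simpl || rewrite ?weaken_byE, ?exchange_byE, ?subst_comp);
  try reflexivity;
  repeat match goal with |- Par _ _ = Par _ _ => f_equal | |- New _ = New _ => f_equal end;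
  repeat match goal with
  | |- subst _ ?P = subst _ ?P => apply subst_ext
  | |- subst _ ?P = ?P => apply subst_id
  | |- ?P = subst _ ?P => symmetry; apply subst_id
  end;
  try (let n := fresh "n" in intros n;
       unfold upb, wk, exch; rewrite ?binds_subst; cbn [binds];
       repeat match goal with |- context [binds ?mu] => destruct (binds mu) end;
       destruct n as [|[|[|n]]]; simpl; reflexivity).

Lemma step_eq P mu nu P' P'' : step P mu P' -> mu = nu -> P' = P'' -> step P nu P''.
Proof. now intros H -> <-. Qed.

Lemma subst_label_comp s t mu : subst_label s (subst_label t mu) = subst_label (fun n => s (t n)) mu.
Proof. now destruct mu. Qed.

(** No rule requires two free names of the process to differ, so identifying names preserves
    transitions; the freshness conditions concern bound names, which [up] keeps apart. *)
Lemma step_subst P mu P' s :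
  step P mu P' -> step (subst s P) (subst_label s mu) (subst (upb mu s) P').
Proof.
  intros H. revert s. induction H; intros s; simpl.
  - constructor.
  - constructor.
  - eapply step_eq; [eapply step_comm_l; [apply IHstep1|apply IHstep2]|reflexivity|rename_by_cases].
  - eapply step_eq; [eapply step_comm_r; [apply IHstep1|apply IHstep2]|reflexivity|rename_by_cases].
  - apply step_open. apply (IHstep (up s)).
  - eapply step_eq; [eapply step_close_l; [apply IHstep1|apply IHstep2]|reflexivity|rename_by_cases].
  - eapply step_eq; [eapply step_close_r; [apply IHstep1|apply IHstep2]|reflexivity|rename_by_cases].
  - eapply step_eq; [eapply step_par_l, IHstep|reflexivity|rename_by_cases].
  - eapply step_eq; [eapply step_par_r, IHstep|reflexivity|rename_by_cases].
  - eapply step_eq; [eapply step_new|reflexivity|].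
    + eapply step_eq; [apply IHstep| |reflexivity]. now rewrite !subst_label_comp.
    + rename_by_cases.
Qed.

(** * Scope extrusion and concurrent actions *)

(* [W] is [P] with one of its active restrictions removed; the restricted name
   becomes the index 0. *)
Inductive extr : proc -> proc -> Prop :=
| extr_top : forall W, extr (New W) W
| extr_par_l : forall P W R, extr P W -> extr (Par P R) (Par W (shift R))
| extr_par_r : forall P W R, extr P W -> extr (Par R P) (Par (shift R) W)
| extr_new : forall P W, extr P W -> extr (New P) (New (subst swap W)).

Lemma extr_eq P W W' : extr P W -> W = W' -> extr P W'.
Proof. now intros H <-. Qed.

Lemma extr_subst P W s : extr P W -> extr (subst s P) (subst (up s) W).
Proof.
  intros H. revert s. induction H; intros s; simpl.
  - constructor.
  - eapply extr_eq; [apply extr_par_l, IHextr|rename_by_cases].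
  - eapply extr_eq; [apply extr_par_r, IHextr|rename_by_cases].
  - eapply extr_eq; [apply extr_new, IHextr|rename_by_cases].
Qed.

(* [P] can do [mu] and [nu] with two parallel prefixes.  The indices in the
   residual are those of the run [mu], then [nu]. *)
Inductive conc : proc -> label -> label -> proc -> Prop :=
| conc_lr : forall P P' Q Q' mu nu,
    step P mu P' -> step Q nu Q' ->
    conc (Par P Q) mu nu (Par (weaken_by nu P') (subst (upb nu (wk mu)) Q'))
| conc_rl : forall P P' Q Q' mu nu,
    step P nu P' -> step Q mu Q' ->
    conc (Par P Q) mu nu (Par (subst (upb nu (wk mu)) P') (weaken_by nu Q'))
| conc_par_l : forall P R mu nu W,
    conc P mu nu W ->
    conc (Par P R) mu nu (Par W (weaken_by nu (weaken_by mu R)))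
| conc_par_r : forall P R mu nu W,
    conc P mu nu W ->
    conc (Par R P) mu nu (Par (weaken_by nu (weaken_by mu R)) W)
| conc_new : forall P mu nu W,
    conc P (subst_label S mu) (subst_label S nu) W ->
    conc (New P) mu nu (New (exchange_by nu (subst (upb nu (exch mu)) W)))
| conc_open_fst : forall P b nu W,
    conc P (LOut (S b) 0) (subst_label S nu) W ->
    conc (New P) (LBOut b) nu W
| conc_open_snd : forall P mu b W,
    conc P (subst_label S mu) (LOut (S b) 0) W ->
    conc (New P) mu (LBOut b) (exchange_by mu W).

Lemma conc_eq P mu nu W W' : conc P mu nu W -> W = W' -> conc P mu nu W'.
Proof. now intros H <-. Qed.

(** The indices of a residual depend on the order of the two actions: reversing it exchanges the two
    innermost indices exactly when both actions bind. *)
Definition exch2 (mu nu : label) : name -> name :=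
  if binds mu then exch nu else fun n => n.

Lemma conc_sym P mu nu W : conc P mu nu W -> conc P nu mu (subst (exch2 mu nu) W).
Proof.
  induction 1; simpl.
  - eapply conc_eq; [eapply conc_rl; eassumption|]; unfold exch2; rename_by_cases.
  - eapply conc_eq; [eapply conc_lr; eassumption|]; unfold exch2; rename_by_cases.
  - eapply conc_eq; [eapply conc_par_l; eassumption|]; unfold exch2; rename_by_cases.
  - eapply conc_eq; [eapply conc_par_r; eassumption|]; unfold exch2; rename_by_cases.
  - eapply conc_eq; [eapply conc_new; eassumption|]; unfold exch2; rename_by_cases.
  - eapply conc_eq; [eapply conc_open_snd; eassumption|]; unfold exch2; rename_by_cases.
  - eapply conc_eq; [eapply conc_open_fst; eassumption|]; unfold exch2; rename_by_cases.
Qed.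

(** Together with [conc_sym], this yields both interleavings of two parallel actions, with residuals
    that agree up to [exch2]. *)
Lemma conc_steps P mu nu W :
  conc P mu nu W -> exists P1, step P mu P1 /\ step P1 (subst_label (wk mu) nu) W.
Proof.
  induction 1.
  - eexists. split; [eapply step_par_l; eassumption|].
    rewrite weaken_byE. eapply step_eq; [eapply step_par_r, step_subst; eassumption|reflexivity|].
    rename_by_cases.
  - eexists. split; [eapply step_par_r; eassumption|].
    rewrite weaken_byE. eapply step_eq; [eapply step_par_l, step_subst; eassumption|reflexivity|].
    rename_by_cases.
  - destruct IHconc as (P1 & H1 & H2). eexists. split; [eapply step_par_l; eassumption|].
    eapply step_eq; [eapply step_par_l; eassumption|reflexivity|]. rename_by_cases.
  - destruct IHconc as (P1 & H1 & H2). eexists. split; [eapply step_par_r; eassumption|].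
    eapply step_eq; [eapply step_par_r; eassumption|reflexivity|]. rename_by_cases.
  - destruct IHconc as (P1 & H1 & H2). eexists. split; [eapply step_new; eassumption|].
    rewrite exchange_byE. apply (step_subst _ _ _ (exch mu)) in H2.
    eapply step_eq; [eapply step_new|reflexivity|].
    + eapply step_eq; [exact H2| |reflexivity].
      rewrite !subst_label_comp. unfold exch, wk. rewrite binds_subst.
      destruct nu, (binds mu); reflexivity.
    + rename_by_cases.
  - destruct IHconc as (P1 & H1 & H2). eexists. split; [eapply step_open; eassumption|].
    eapply step_eq; [exact H2| |reflexivity].
    unfold wk; simpl. now destruct nu.
  - destruct IHconc as (P1 & H1 & H2). eexists. split; [eapply step_new; eassumption|].
    rewrite !exchange_byE. simpl. apply step_open.
    apply (step_subst _ _ _ (exch mu)) in H2. eapply step_eq; [exact H2| |rename_by_cases].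
    unfold exch, wk. rewrite binds_subst. simpl. destruct (binds mu); reflexivity.
Qed.

Definition is_output (mu : label) (b : name) : Prop :=
  match mu with
  | LOut b' _ | LBOut b' => b' = b
  | LInp _ | LTau => False
  end.

(* [W] is the residual of the output [o] followed by an input, and [V] results
   from the silent step which fuses the two.  [V] need not be a restriction when
   [o] is a bound output, since the communication may take place below the
   restriction that [o] opens. *)
Definition fused (s : name -> name) (o : label) (W V : proc) : Prop :=
  match o with
  | LOut _ c => V = subst (inst (s c)) (subst (up s) W)
  | LBOut _ => extr V (subst (inst 0) (subst (up (up s)) W))
  | LInp _ | LTau => False
  end.

Lemma fused_par_l s o a W V R :
  fused s o W V ->
  fused s o (Par W (weaken_by (LInp a) (weaken_by o R))) (Par V (subst s R)).
Proof.
  destruct o; simpl; try easy.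
  - intros ->. rename_by_cases.
  - intros H. eapply extr_eq; [apply extr_par_l, H|rename_by_cases].
Qed.

Lemma fused_par_r s o a W V R :
  fused s o W V ->
  fused s o (Par (weaken_by (LInp a) (weaken_by o R)) W) (Par (subst s R) V).
Proof.
  destruct o; simpl; try easy.
  - intros ->. rename_by_cases.
  - intros H. eapply extr_eq; [apply extr_par_r, H|rename_by_cases].
Qed.

Lemma fused_new s o a W V :
  fused (up s) (subst_label S o) W V ->
  fused s o (New (exchange_by (LInp a) (subst (upb (LInp a) (exch o)) W))) (New V).
Proof.
  destruct o; simpl; try easy.
  - intros ->. rename_by_cases.
  - intros H. eapply extr_eq; [apply extr_new, H|rename_by_cases].
Qed.

Lemma fused_open s b W V :
  fused (up s) (LOut (S b) 0) W V -> fused s (LBOut b) W (New V).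
Proof. simpl. intros ->. apply extr_top. Qed.

(** At the parallel composition that separates the two prefixes, equal subjects allow a
    communication, or a closing if the output is already bound there; the context above transports
    the silent step. *)
Lemma conc_step_tau P o a b W s :
  conc P o (LInp a) W -> is_output o b -> s a = s b ->
  exists V, step (subst s P) LTau V /\ fused s o W V.
Proof.
  remember (LInp a) as mu eqn:E. intros H. revert a b s E.
  induction H; intros a0 b0 s E Ho Hs; subst; simpl.
  - apply (step_subst _ _ _ s) in H, H0. simpl in H0. rewrite Hs in H0.
    destruct mu; simpl in *; try easy; subst.
    + eexists. split; [eapply step_comm_r; eassumption|]. rename_by_cases.
    + eexists. split; [eapply step_close_r; eassumption|].
      eapply extr_eq; [apply extr_top|rename_by_cases].
  - apply (step_subst _ _ _ s) in H, H0. simpl in H. rewrite Hs in H.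
    destruct mu; simpl in *; try easy; subst.
    + eexists. split; [eapply step_comm_l; eassumption|]. rename_by_cases.
    + eexists. split; [eapply step_close_l; eassumption|].
      eapply extr_eq; [apply extr_top|rename_by_cases].
  - destruct (IHconc _ _ s eq_refl Ho Hs) as (V & H1 & H2).
    eexists. split; [apply step_par_l, H1|]. now apply fused_par_l.
  - destruct (IHconc _ _ s eq_refl Ho Hs) as (V & H1 & H2).
    eexists. split; [apply step_par_r, H1|]. now apply fused_par_r.
  - destruct (IHconc (S a0) (S b0) (up s) eq_refl) as (V & H1 & H2).
    + destruct mu; simpl in *; congruence.
    + simpl. congruence.
    + eexists. split; [apply step_new, H1|]. now apply fused_new.
  (* Below the restriction that it opens, the output is free: the communication takes place there
     and the restriction stays on top. *)
  - destruct (IHconc (S a0) (S b0) (up s) eq_refl) as (V & H1 & H2).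
    + simpl in *; congruence.
    + simpl. congruence.
    + eexists. split; [apply step_new, H1|]. now apply (fused_open s b).
  - discriminate.
Qed.

(** * Transitions of substituted processes *)

Definition lifts_step (s : name -> name) (P : proc) (mu : label) (V : proc) : Prop :=
  exists mu0 P0, step P mu0 P0 /\ mu = subst_label s mu0 /\ V = subst (upb mu0 s) P0.

Definition merges (s : name -> name) (P : proc) (V : proc) : Prop :=
  exists a b o W, a <> b /\ s a = s b /\ is_output o b /\ conc P o (LInp a) W /\ fused s o W V.

Lemma merges_intro s P a b o W V :
  conc P o (LInp a) W -> fused s o W V -> is_output o b -> a <> b -> s a = s b -> merges s P V.
Proof. intros. exists a, b, o, W. auto. Qed.

Ltac subst_labels :=
  repeat match goal with
  | H : _ = subst_label _ ?mu |- _ => destruct mu; simpl in H; try discriminate H; []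
  | H : LInp _ = LInp _ |- _ => injection H as H
  | H : LBOut _ = LBOut _ |- _ => injection H as H
  | H : LOut _ _ = LOut _ _ |- _ => injection H as ? ?
  end.

Lemma subst_label_up_S s mu nu :
  subst_label S mu = subst_label (up s) nu ->
  exists nu', nu = subst_label S nu' /\ mu = subst_label s nu'.
Proof.
  destruct mu as [a|a b|a|], nu as [c|c d|c|]; simpl; try discriminate.
  - intros [= H]. destruct c as [|c]; [discriminate|]. injection H as ->. now exists (LInp c).
  - intros [= H H']. destruct c as [|c]; [discriminate|]. destruct d as [|d]; [discriminate|].
    injection H as ->. injection H' as ->. now exists (LOut c d).
  - intros [= H]. destruct c as [|c]; [discriminate|]. injection H as ->. now exists (LBOut c).
  - now exists LTau.
Qed.

(** [up s] never identifies the index 0 with another one, so both subjects come from outside the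
    restriction. The restricted name can still be the object of the output, which then opens the
    restriction. *)
Lemma up_identified_subjects s o a b :
  a <> b -> is_output o b -> up s a = up s b ->
  exists a' b', a = S a' /\ b = S b' /\ a' <> b' /\ s a' = s b' /\
  ((exists o', o = subst_label S o' /\ is_output o' b') \/ o = LOut (S b') 0).
Proof.
  intros Hab Ho Hs.
  destruct a as [|a], b as [|b]; try discriminate; [easy|].
  injection Hs as Hs. exists a, b. repeat split; auto.
  destruct o as [c|c d|c|]; simpl in Ho; try easy; subst.
  - destruct d as [|d]; [now right|left]. now exists (LOut b d).
  - left. now exists (LBOut b).
Qed.

(** Only the four communication rules require two subjects to agree. If these agreed before the
    substitution, the transition lifts; otherwise two parallel prefixes have distinct subjects that
    [s] merges. *)
Lemma step_subst_inv P s mu V :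
  step (subst s P) mu V -> lifts_step s P mu V \/ mu = LTau /\ merges s P V.
Proof.
  revert s mu V. induction P as [|m P IH|m n P IH|P IHP Q IHQ|P IH]; intros s mu V H; simpl in H;
    inversion H; subst; clear H.
  - left. exists (LInp m), P. repeat split. constructor.
  - left. exists (LOut m n), P. repeat split. constructor.
  - match goal with H : step (subst s P) _ _ |- _ =>
      apply IHP in H as [(mu0 & P0 & HP & E & ->)|[? _]]; [|discriminate] end.
    match goal with H : step (subst s Q) _ _ |- _ =>
      apply IHQ in H as [(nu0 & Q0 & HQ & F & ->)|[? _]]; [|discriminate] end.
    subst_labels. subst.
    match goal with H : s ?x = s ?y |- _ => destruct (Nat.eq_dec x y) as [->|Hn] end.
    + left. eexists LTau, _. split; [eapply step_comm_l; eassumption|]. split; [reflexivity|].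
      rename_by_cases.
    + right. split; [reflexivity|].
      eapply merges_intro; [eapply conc_rl; eassumption| |reflexivity|congruence|congruence].
      rename_by_cases.
  - match goal with H : step (subst s P) _ _ |- _ =>
      apply IHP in H as [(mu0 & P0 & HP & E & ->)|[? _]]; [|discriminate] end.
    match goal with H : step (subst s Q) _ _ |- _ =>
      apply IHQ in H as [(nu0 & Q0 & HQ & F & ->)|[? _]]; [|discriminate] end.
    subst_labels. subst.
    match goal with H : s ?x = s ?y |- _ => destruct (Nat.eq_dec x y) as [->|Hn] end.
    + left. eexists LTau, _. split; [eapply step_comm_r; eassumption|]. split; [reflexivity|].
      rename_by_cases.
    + right. split; [reflexivity|].
      eapply merges_intro; [eapply conc_lr; eassumption| |reflexivity|congruence|congruence].
      rename_by_cases.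
  - match goal with H : step (subst s P) _ _ |- _ =>
      apply IHP in H as [(mu0 & P0 & HP & E & ->)|[? _]]; [|discriminate] end.
    match goal with H : step (subst s Q) _ _ |- _ =>
      apply IHQ in H as [(nu0 & Q0 & HQ & F & ->)|[? _]]; [|discriminate] end.
    subst_labels. subst.
    match goal with H : s ?x = s ?y |- _ => destruct (Nat.eq_dec x y) as [->|Hn] end.
    + left. eexists LTau, _. split; [eapply step_close_l; eassumption|]. split; [reflexivity|].
      rename_by_cases.
    + right. split; [reflexivity|].
      eapply merges_intro; [eapply conc_rl; eassumption| |reflexivity|congruence|congruence].
      eapply extr_eq; [apply extr_top|rename_by_cases].
  - match goal with H : step (subst s P) _ _ |- _ =>
      apply IHP in H as [(mu0 & P0 & HP & E & ->)|[? _]]; [|discriminate] end.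
    match goal with H : step (subst s Q) _ _ |- _ =>
      apply IHQ in H as [(nu0 & Q0 & HQ & F & ->)|[? _]]; [|discriminate] end.
    subst_labels. subst.
    match goal with H : s ?x = s ?y |- _ => destruct (Nat.eq_dec x y) as [->|Hn] end.
    + left. eexists LTau, _. split; [eapply step_close_r; eassumption|]. split; [reflexivity|].
      rename_by_cases.
    + right. split; [reflexivity|].
      eapply merges_intro; [eapply conc_lr; eassumption| |reflexivity|congruence|congruence].
      eapply extr_eq; [apply extr_top|rename_by_cases].
  - match goal with H : step (subst s P) _ _ |- _ => apply IHP in H; rename H into Hstep end.
    destruct Hstep as [(mu0 & P0 & HP & -> & ->)|[-> (a & b & o & W & Hab & Hs & Ho & HW & HV)]].
    + left. eexists mu0, _. split; [apply step_par_l, HP|]. split; [reflexivity|].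
      rename_by_cases.
    + right. split; [reflexivity|]. eexists a, b, o, _. do 3 (split; [now auto|]). split; [apply conc_par_l, HW|].
      now apply fused_par_l.
  - match goal with H : step (subst s Q) _ _ |- _ => apply IHQ in H; rename H into Hstep end.
    destruct Hstep as [(mu0 & P0 & HP & -> & ->)|[-> (a & b & o & W & Hab & Hs & Ho & HW & HV)]].
    + left. eexists mu0, _. split; [apply step_par_r, HP|]. split; [reflexivity|].
      rename_by_cases.
    + right. split; [reflexivity|]. eexists a, b, o, _. do 3 (split; [now auto|]). split; [apply conc_par_r, HW|].
      now apply fused_par_r.
  - match goal with H : step (subst (up s) P) _ _ |- _ => apply IH in H; rename H into Hstep end.
    destruct Hstep as [(mu0 & P0 & HP & E & ->)|[? _]]; [|discriminate].
    (* Only the index 0 is sent to 0 by [up s], so the emitted name was already the restricted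
       one. *)
    destruct mu0 as [|c d| |]; try discriminate. injection E as E1 E2.
    destruct c as [|c]; [discriminate|]. destruct d as [|d]; [|discriminate].
    injection E1 as ->. left. exists (LBOut c), P0. repeat split. now apply step_open.
  - match goal with H : step (subst (up s) P) _ _ |- _ => apply IH in H; rename H into Hstep end.
    destruct Hstep as [(mu0 & P0 & HP & E & ->)|[E (a & b & o & W & Hab & Hs & Ho & HW & HV)]].
    + apply subst_label_up_S in E as (nu & -> & ->). left.
      eexists nu, _. split; [apply step_new, HP|]. split; [reflexivity|]. rename_by_cases.
    + right. destruct mu; try discriminate. split; [reflexivity|].
      destruct (up_identified_subjects _ _ _ _ Hab Ho Hs)
        as (a' & b' & -> & -> & Hab' & Hs' & [(o' & -> & Ho')| ->]).
      * eexists a', b', o', _. do 3 (split; [now auto|]). split; [apply conc_new, HW|]. now apply fused_new.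
      * eexists a', b', (LBOut b'), _. do 3 (split; [now auto|]). split; [apply conc_open_fst, HW|].
        now apply (fused_open s b').
Qed.

Lemma step_subst_injective_inv P s mu V :
  (forall m n, s m = s n -> m = n) -> step (subst s P) mu V -> lifts_step s P mu V.
Proof.
  intros Hs [H|[_ (a & b & o & W & Hab & E & _)]]%step_subst_inv; [exact H|].
  now apply Hs in E.
Qed.

Lemma step_subst_involutive P f mu V :
  (forall n, f (f n) = n) -> step (subst f P) mu V ->
  step P (subst_label f mu) (subst (upb mu f) V).
Proof.
  intros Hf H. apply (step_subst _ _ _ f) in H. rewrite subst_comp, subst_id in H; auto.
Qed.

(** * Transitions and scope extrusion *)

Lemma swap_swap n : swap (swap n) = n.
Proof. now destruct n as [|[|n]]. Qed.

Lemma subst_swap_S_S mu : subst_label swap (subst_label S (subst_label S mu)) = subst_label S (subst_label S mu).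
Proof. now destruct mu. Qed.

(** The second alternative is the bound output that opens the extracted restriction: in [W] it is a
    free output of the index 0. *)
Lemma extr_step P W mu P' :
  extr P W -> step P mu P' ->
  (exists W', step W (subst_label S mu) W' /\ extr P' (exchange_by mu W')) \/
  (exists b, mu = LBOut b /\ step W (LOut (S b) 0) P').
Proof.
  intros H. revert mu P'. induction H as [W|P W R H IH|P W R H IH|P W H IH]; intros mu P' Hs.
  - inversion Hs; subst.
    + right. eauto.
    + left. eexists. split; [eassumption|apply extr_top].
  - inversion Hs; subst; clear Hs;
      try (match goal with H : step P _ _ |- _ => rename H into HP end);
      try (match goal with H : step R _ _ |- _ => rename H into HR end).
    + apply IH in HP as [(W' & HW & HE)|(? & ? & _)]; [|discriminate].
      apply (step_subst _ _ _ S) in HR. left. eexists. split; [eapply step_comm_l; eassumption|].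
      eapply extr_eq; [apply extr_par_l, extr_subst, HE|rename_by_cases].
    + apply IH in HP as [(W' & HW & HE)|(? & ? & _)]; [|discriminate].
      apply (step_subst _ _ _ S) in HR. left. eexists. split; [eapply step_comm_r; eassumption|].
      eapply extr_eq; [apply extr_par_l, HE|rename_by_cases].
    + apply IH in HP as [(W' & HW & HE)|(? & ? & _)]; [|discriminate].
      apply (step_subst _ _ _ S) in HR. left. eexists. split; [eapply step_close_l; eassumption|].
      eapply extr_eq; [apply extr_new, extr_par_l, HE|rename_by_cases].
    + apply (step_subst _ _ _ S) in HR.
      apply IH in HP as [(W' & HW & HE)|(b & [= ->] & HW)]; left; eexists.
      * split; [eapply step_close_r; eassumption|].
        eapply extr_eq; [apply extr_new, extr_par_l, HE|rename_by_cases].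
      (* The closing transmits the extracted name. In [W] it is a communication of the index 0, and
         the restriction created by the closing is the extracted one. *)
      * split; [eapply step_comm_r; eassumption|].
        replace (subst (inst 0) _) with Q' by rename_by_cases. apply extr_top.
    + apply IH in HP as [(W' & HW & HE)|(b & -> & HW)].
      * left. eexists. split; [apply step_par_l, HW|].
        eapply extr_eq; [apply extr_par_l, HE|rename_by_cases].
      * right. exists b. split; [reflexivity|]. exact (step_par_l (LOut (S b) 0) _ _ (shift R) HW).
    + apply (step_subst _ _ _ S) in HR. left. eexists. split; [apply step_par_r, HR|].
      eapply extr_eq; [apply extr_par_l|].
      * rewrite weaken_byE. apply extr_subst. exact H.
      * rename_by_cases.
  - inversion Hs; subst; clear Hs;
      try (match goal with H : step P _ _ |- _ => rename H into HP end);
      try (match goal with H : step R _ _ |- _ => rename H into HR end).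
    + apply IH in HP as [(W' & HW & HE)|(? & ? & _)]; [|discriminate].
      apply (step_subst _ _ _ S) in HR. left. eexists. split; [eapply step_comm_l; eassumption|].
      eapply extr_eq; [apply extr_par_r, HE|rename_by_cases].
    + apply IH in HP as [(W' & HW & HE)|(? & ? & _)]; [|discriminate].
      apply (step_subst _ _ _ S) in HR. left. eexists. split; [eapply step_comm_r; eassumption|].
      eapply extr_eq; [apply extr_par_r, extr_subst, HE|rename_by_cases].
    + apply (step_subst _ _ _ S) in HR.
      apply IH in HP as [(W' & HW & HE)|(b & [= ->] & HW)]; left; eexists.
      * split; [eapply step_close_l; eassumption|].
        eapply extr_eq; [apply extr_new, extr_par_r, HE|rename_by_cases].
      * split; [eapply step_comm_l; eassumption|].
        replace (subst (inst 0) _) with P'0 by rename_by_cases. apply extr_top.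
    + apply IH in HP as [(W' & HW & HE)|(? & ? & _)]; [|discriminate].
      apply (step_subst _ _ _ S) in HR. left. eexists. split; [eapply step_close_r; eassumption|].
      eapply extr_eq; [apply extr_new, extr_par_r, HE|rename_by_cases].
    + apply (step_subst _ _ _ S) in HR. left. eexists. split; [apply step_par_l, HR|].
      eapply extr_eq; [apply extr_par_r|].
      * rewrite weaken_byE. apply extr_subst. exact H.
      * rename_by_cases.
    + apply IH in HP as [(W' & HW & HE)|(b & -> & HW)].
      * left. eexists. split; [apply step_par_r, HW|].
        eapply extr_eq; [apply extr_par_r, HE|rename_by_cases].
      * right. exists b. split; [reflexivity|]. exact (step_par_r (LOut (S b) 0) (shift R) _ _ HW).
  - inversion Hs; subst; clear Hs;
      try (match goal with H : step P _ _ |- _ => rename H into HP end).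
    + apply IH in HP as [(W' & HW & HE)|(? & ? & _)]; [|discriminate].
      apply (step_subst _ _ _ swap) in HW. left. eexists. split; [apply step_open, HW|].
      eapply extr_eq; [exact HE|rename_by_cases].
    + apply IH in HP as [(W' & HW & HE)|(b & E & HW)]; apply (step_subst _ _ _ swap) in HW.
      * left. rewrite subst_swap_S_S in HW. eexists. split; [apply step_new, HW|].
        rewrite exchange_byE in *.
        eapply extr_eq; [apply extr_new|].
        -- apply extr_subst, HE.
        -- rename_by_cases.
      * right. destruct mu as [| |a|]; try discriminate. injection E as <-.
        exists a. split; [reflexivity|]. apply step_new with (mu := LOut (S a) 0). exact HW.
Qed.

Lemma step_shift_inv R mu R' :
  step (shift R) mu R' ->
  exists mu0 R0, step R mu0 R0 /\ mu = subst_label S mu0 /\ R' = subst (upb mu0 S) R0.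
Proof. apply step_subst_injective_inv. congruence. Qed.

Lemma subst_label_S_inj mu nu : subst_label S mu = subst_label S nu -> mu = nu.
Proof. destruct mu, nu; simpl; congruence. Qed.

(** The two cases cover all labels except those whose subject is the index 0, which the restriction
    blocks in [P]. *)
Lemma extr_step_inv P W nu W' :
  extr P W -> step W nu W' ->
  (forall mu, nu = subst_label S mu -> exists P', step P mu P' /\ extr P' (exchange_by mu W')) /\
  (forall b, nu = LOut (S b) 0 -> step P (LBOut b) W').
Proof.
  intros H. revert nu W'. induction H as [W|P W R H IH|P W R H IH|P W H IH]; intros nu W' Hs.
  - split.
    + intros mu ->. eexists. split; [apply step_new, Hs|apply extr_top].
    + intros b ->. apply step_open, Hs.
  - inversion Hs; subst; clear Hs;
      try (match goal with H : step W _ _ |- _ => rename H into HW; apply IH in HW as [IH1 IH2] end);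
      try (match goal with H : step (shift R) _ _ |- _ =>
             apply step_shift_inv in H as (nu0 & R0 & HR & E & ->) end).
    + destruct nu0 as [|c d| |]; try discriminate. injection E as -> ->.
      destruct (IH1 (LInp c) eq_refl) as (P1 & HP & HE).
      split; [intros mu Hmu|discriminate]. destruct mu; try discriminate.
      eexists. split; [eapply step_comm_l; eassumption|].
      eapply extr_eq; [apply extr_par_l, extr_subst, HE|rename_by_cases].
    + destruct nu0 as [c| | |]; try discriminate. injection E as ->.
      split; [intros mu Hmu|discriminate]. destruct mu; try discriminate.
      (* Sending the index 0 amounts, in [P], to sending a restricted name out of its scope, hence a
         closing; any other object gives a plain communication. *)
      destruct b as [|d].
      * eexists. split; [eapply step_close_r; [apply IH2; reflexivity|exact HR]|].
        eapply extr_eq; [apply extr_top|rename_by_cases].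
      * destruct (IH1 (LOut c d) eq_refl) as (P1 & HP & HE).
        eexists. split; [eapply step_comm_r; eassumption|].
        eapply extr_eq; [apply extr_par_l, HE|rename_by_cases].
    + destruct nu0 as [| |c|]; try discriminate. injection E as ->.
      destruct (IH1 (LInp c) eq_refl) as (P1 & HP & HE).
      split; [intros mu Hmu|discriminate]. destruct mu; try discriminate.
      eexists. split; [eapply step_close_l; eassumption|].
      eapply extr_eq; [apply extr_new, extr_par_l, HE|rename_by_cases].
    + destruct nu0 as [c| | |]; try discriminate. injection E as ->.
      destruct (IH1 (LBOut c) eq_refl) as (P1 & HP & HE).
      split; [intros mu Hmu|discriminate]. destruct mu; try discriminate.
      eexists. split; [eapply step_close_r; eassumption|].
      eapply extr_eq; [apply extr_new, extr_par_l, HE|rename_by_cases].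
    + split.
      * intros mu ->. destruct (IH1 mu eq_refl) as (P1 & HP & HE).
        eexists. split; [apply step_par_l, HP|].
        eapply extr_eq; [apply extr_par_l, HE|rename_by_cases].
      * intros b ->. exact (step_par_l (LBOut b) _ _ R (IH2 b eq_refl)).
    + split.
      * intros mu ->. apply subst_label_S_inj in E as ->.
        eexists. split; [apply step_par_r, HR|]. rewrite weaken_byE.
        eapply extr_eq; [apply extr_par_l, extr_subst, H|rename_by_cases].
      * intros b ->. destruct nu0; discriminate.
  - inversion Hs; subst; clear Hs;
      try (match goal with H : step W _ _ |- _ => rename H into HW; apply IH in HW as [IH1 IH2] end);
      try (match goal with H : step (shift R) _ _ |- _ =>
             apply step_shift_inv in H as (nu0 & R0 & HR & E & ->) end).
    + destruct nu0 as [c| | |]; try discriminate. injection E as ->.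
      split; [intros mu Hmu|discriminate]. destruct mu; try discriminate.
      destruct b as [|d].
      * eexists. split; [eapply step_close_l; [exact HR|apply IH2; reflexivity]|].
        eapply extr_eq; [apply extr_top|rename_by_cases].
      * destruct (IH1 (LOut c d) eq_refl) as (P1 & HP & HE).
        eexists. split; [eapply step_comm_l; eassumption|].
        eapply extr_eq; [apply extr_par_r, HE|rename_by_cases].
    + destruct nu0 as [|c d| |]; try discriminate. injection E as -> ->.
      destruct (IH1 (LInp c) eq_refl) as (P1 & HP & HE).
      split; [intros mu Hmu|discriminate]. destruct mu; try discriminate.
      eexists. split; [eapply step_comm_r; eassumption|].
      eapply extr_eq; [apply extr_par_r, extr_subst, HE|rename_by_cases].
    + destruct nu0 as [c| | |]; try discriminate. injection E as ->.
      destruct (IH1 (LBOut c) eq_refl) as (P1 & HP & HE).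
      split; [intros mu Hmu|discriminate]. destruct mu; try discriminate.
      eexists. split; [eapply step_close_l; eassumption|].
      eapply extr_eq; [apply extr_new, extr_par_r, HE|rename_by_cases].
    + destruct nu0 as [| |c|]; try discriminate. injection E as ->.
      destruct (IH1 (LInp c) eq_refl) as (P1 & HP & HE).
      split; [intros mu Hmu|discriminate]. destruct mu; try discriminate.
      eexists. split; [eapply step_close_r; eassumption|].
      eapply extr_eq; [apply extr_new, extr_par_r, HE|rename_by_cases].
    + split.
      * intros mu ->. apply subst_label_S_inj in E as ->.
        eexists. split; [apply step_par_l, HR|]. rewrite weaken_byE.
        eapply extr_eq; [apply extr_par_r, extr_subst, H|rename_by_cases].
      * intros b ->. destruct nu0; discriminate.
    + split.
      * intros mu ->. destruct (IH1 mu eq_refl) as (P1 & HP & HE).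
        eexists. split; [apply step_par_r, HP|].
        eapply extr_eq; [apply extr_par_r, HE|rename_by_cases].
      * intros b ->. exact (step_par_r (LBOut b) R _ _ (IH2 b eq_refl)).
  - inversion Hs; subst; clear Hs;
      match goal with H : step (subst swap W) _ _ |- _ =>
        apply (step_subst_involutive _ _ _ _ swap_swap) in H; apply IH in H as [IH1 IH2] end.
    + split; [|discriminate]. intros mu E. destruct mu as [| |c|]; try discriminate.
      injection E as ->. destruct (IH1 (LOut (S c) 0) eq_refl) as (P1 & HP & HE).
      eexists. split; [apply step_open, HP|].
      eapply extr_eq; [exact HE|rename_by_cases].
    + split.
      * intros mu ->. destruct (IH1 (subst_label S mu)) as (P1 & HP & HE).
        { apply subst_swap_S_S. }
        eexists. split; [apply step_new, HP|]. rewrite exchange_byE.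
        eapply extr_eq; [apply extr_new, extr_subst, HE|rename_by_cases].
      * intros b ->. specialize (IH2 (S b) eq_refl).
        eapply step_eq; [apply (step_new (LBOut b)), IH2|reflexivity|].
        rename_by_cases.
Qed.

(** * Ground bisimilarity: equivalence and closure properties *)

Lemma ground_bisimilar_bisimulation : ground_bisimulation ground_bisimilar.
Proof.
  split.
  - intros P Q (R & HR & H). exists R. split; [exact HR|]. now apply HR.
  - intros P Q mu P' (R & HR & H) Hs. destruct (proj2 HR _ _ _ _ H Hs) as (Q' & ? & ?).
    exists Q'. split; [assumption|]. now exists R.
Qed.

Lemma ground_bisimilar_sym P Q : ground_bisimilar P Q -> ground_bisimilar Q P.
Proof. apply ground_bisimilar_bisimulation. Qed.

Lemma ground_bisimilar_step P Q mu P' :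
  ground_bisimilar P Q -> step P mu P' -> exists Q', step Q mu Q' /\ ground_bisimilar P' Q'.
Proof. apply ground_bisimilar_bisimulation. Qed.

Lemma ground_bisimilar_refl P : ground_bisimilar P P.
Proof. exists eq. split; [split|]; [auto| |reflexivity]. intros ? Q mu P' -> H. eauto. Qed.

Lemma ground_bisimilar_trans P Q U :
  ground_bisimilar P Q -> ground_bisimilar Q U -> ground_bisimilar P U.
Proof.
  intros H1 H2. exists (fun P U => exists Q, ground_bisimilar P Q /\ ground_bisimilar Q U).
  split; [split|eauto].
  - intros A B (C & ? & ?). exists C. split; now apply ground_bisimilar_sym.
  - intros A B mu A' (C & HAC & HCB) Hs.
    destruct (ground_bisimilar_step _ _ _ _ HAC Hs) as (C' & Hs' & ?).
    destruct (ground_bisimilar_step _ _ _ _ HCB Hs') as (B' & ? & ?). eauto.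
Qed.

Lemma ground_bisimilar_injective P Q f :
  (forall m n, f m = f n -> m = n) -> ground_bisimilar P Q ->
  ground_bisimilar (subst f P) (subst f Q).
Proof.
  intros Hf H.
  (* The renaming is quantified inside the relation because a binding label turns it into its image
     under [up]. *)
  exists (fun P Q => exists f P0 Q0, (forall m n : name, f m = f n -> m = n) /\
    ground_bisimilar P0 Q0 /\ P = subst f P0 /\ Q = subst f Q0).
  split; [split|exists f, P, Q; auto].
  - intros A B (g & P0 & Q0 & Hg & H0 & -> & ->). exists g, Q0, P0. auto using ground_bisimilar_sym.
  - intros A B mu A' (g & P0 & Q0 & Hg & H0 & -> & ->) Hs.
    apply step_subst_injective_inv in Hs as (mu0 & P1 & HP & -> & ->); [|exact Hg].
    destruct (ground_bisimilar_step _ _ _ _ H0 HP) as (Q1 & HQ & H1).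
    exists (subst (upb mu0 g) Q1). split; [now apply step_subst|].
    exists (upb mu0 g), P1, Q1. repeat split; auto.
    unfold upb. destruct (binds mu0); [|exact Hg].
    intros [|m] [|n] E; try discriminate; auto.
Qed.

Lemma exch_injective mu m n : exch mu m = exch mu n -> m = n.
Proof.
  unfold exch. destruct (binds mu); [|easy].
  intros H. rewrite <- (swap_swap m), H. apply swap_swap.
Qed.

Lemma ground_bisimilar_new P Q : ground_bisimilar P Q -> ground_bisimilar (New P) (New Q).
Proof.
  intros H.
  (* Bisimilarity itself is included for the bound outputs that open the restriction. *)
  exists (fun P Q => ground_bisimilar P Q \/
    exists P0 Q0, ground_bisimilar P0 Q0 /\ P = New P0 /\ Q = New Q0).
  split; [split|eauto 7].
  - intros A B [H0|(P0 & Q0 & H0 & -> & ->)]; [left; now apply ground_bisimilar_sym|right].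
    exists Q0, P0. auto using ground_bisimilar_sym.
  - intros A B mu A' [H0|(P0 & Q0 & H0 & -> & ->)] Hs.
    + destruct (ground_bisimilar_step _ _ _ _ H0 Hs) as (? & ? & ?). eauto.
    + inversion Hs; subst;
        match goal with H : step P0 _ _ |- _ =>
          destruct (ground_bisimilar_step _ _ _ _ H0 H) as (Q' & HQ & HR) end.
      * exists Q'. split; [now apply step_open|auto].
      * eexists. split; [apply step_new, HQ|right]. rewrite !exchange_byE.
        do 2 eexists. split; [|split; reflexivity].
        apply ground_bisimilar_injective; [apply exch_injective|exact HR].
Qed.

(** An active restriction can be brought to the top, so restriction is the only context by which the
    final relation has to be closed. *)
Lemma extr_ground_bisimilar P W : extr P W -> ground_bisimilar P (New W).
Proof.
  intros H.
  (* Equal pairs arise when the extracted restriction is opened: both sides then reach the same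
     process. *)
  exists (fun P Q => P = Q \/ exists P0 W, extr P0 W /\ (P = P0 /\ Q = New W \/ P = New W /\ Q = P0)).
  split; [split|right; exists P, W; auto].
  - intros A B [->|(P0 & W0 & H0 & HAB)]; [now left|right]. exists P0, W0. tauto.
  - intros A B mu A' [->|(P0 & W0 & H0 & [[-> ->]|[-> ->]])] Hs; [eauto| |].
    + destruct (extr_step _ _ _ _ H0 Hs) as [(W' & HW & HE)|(b & -> & HW)].
      * eexists. split; [apply step_new, HW|]. right. eauto 6.
      * exists A'. split; [now apply step_open|now left].
    + inversion Hs; subst;
        match goal with H : step W0 _ _ |- _ => apply (extr_step_inv _ _ _ _ H0) in H as [H1 H2] end.
      * exists A'. split; [now apply H2|now left].
      * destruct (H1 _ eq_refl) as (P1 & HP & HE). exists P1. split; [exact HP|right; eauto 6].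
Qed.

(** * Erasure to forests *)

(** The value [false] at the index 0 discards bound names, so that only actions with a free subject
    survive in the erasure. *)
Definition elift (mu : label) (f : bool -> name -> bool) (k : bool) (n : name) : bool :=
  if binds mu then match n with 0 => false | S m => f k m end else f k n.

Lemma elift_subst_label s mu : elift (subst_label s mu) = elift mu.
Proof. unfold elift. now rewrite binds_subst. Qed.

(* In the erasure, [true] stands for inputs and [false] for outputs; [f] selects
   the subjects that are kept. *)
Fixpoint erase (f : bool -> name -> bool) (P : proc) : list (tree bool) :=
  match P with
  | Nil => []
  | Inp m P1 => if f true m then [Node true (erase (elift (LInp m) f) P1)] else []
  | Out m _ P1 => if f false m then [Node false (erase f P1)] else []
  | Par P1 P2 => erase f P1 ++ erase f P2
  | New P1 => erase (elift (LBOut 0) f) P1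
  end.

Definition kept (f : bool -> name -> bool) (mu : label) (k : bool) : Prop :=
  match mu with
  | LInp a => k = true /\ f true a = true
  | LOut b _ | LBOut b => k = false /\ f false b = true
  | LTau => False
  end.

Lemma erase_ext f g P : (forall k n, f k n = g k n) -> erase f P = erase g P.
Proof.
  revert f g. induction P as [|m P IH|m n P IH|P IHP Q IHQ|P IH]; intros f g H; simpl.
  - reflexivity.
  - rewrite H. destruct (g true m); [|reflexivity]. do 2 f_equal.
    apply IH. intros k [|n]; simpl; [reflexivity|apply H].
  - rewrite H. destruct (g false m); [|reflexivity]. do 2 f_equal. auto.
  - f_equal; auto.
  - apply IH. intros k [|n]; simpl; [reflexivity|apply H].
Qed.

Lemma erase_subst f s P : erase f (subst s P) = erase (fun k n => f k (s n)) P.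
Proof.
  revert f s. induction P as [|m P IH|m n P IH|P IHP Q IHQ|P IH]; intros f s; simpl.
  - reflexivity.
  - destruct (f true (s m)); [|reflexivity]. do 2 f_equal. rewrite IH.
    apply erase_ext. now intros k [|n].
  - destruct (f false (s m)); [|reflexivity]. do 2 f_equal. auto.
  - f_equal; auto.
  - rewrite IH. apply erase_ext. now intros k [|n].
Qed.

Ltac erase_by_cases :=
  rewrite ?weaken_byE, ?exchange_byE, ?erase_subst; apply erase_ext;
  let k := fresh "k" in let n := fresh "n" in intros k n;
  unfold elift, upb, wk, exch, exch2; rewrite ?binds_subst; cbn [binds];
  repeat match goal with |- context [binds ?mu] => destruct (binds mu) end;
  destruct n as [|[|[|n]]]; simpl; reflexivity.

Lemma erase_weaken_by f mu P : erase (elift mu f) (weaken_by mu P) = erase f P.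
Proof. erase_by_cases. Qed.

Lemma kept_subst_label f s mu k : kept f (subst_label s mu) k <-> kept (fun k n => f k (s n)) mu k.
Proof. now destruct mu. Qed.

Lemma step_erase f P mu P' k :
  step P mu P' -> kept f mu k -> fstep (erase f P) k (erase (elift mu f) P').
Proof.
  intros H. revert f k. induction H; intros f k Hk; simpl in Hk; try easy; simpl.
  - destruct Hk as [-> ->]. exists (erase (elift (LInp a) f) P), []. now rewrite app_nil_r.
  - destruct Hk as [-> ->]. exists (erase f P), []. rewrite app_nil_r. split; [reflexivity|].
    now rewrite (erase_ext _ f).
  - destruct Hk as [-> Hk]. apply (IHstep (elift (LBOut 0) f)). simpl. auto.
  - rewrite erase_weaken_by. apply fstep_app_l. auto.
  - rewrite erase_weaken_by. apply fstep_app_r. auto.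
  - replace (erase (elift (LBOut 0) (elift mu f)) (exchange_by mu P'))
      with (erase (elift (subst_label S mu) (elift (LBOut 0) f)) P') by erase_by_cases.
    apply IHstep. now apply kept_subst_label.
Qed.

Lemma fstep_single_inv {A} (a b : A) S F : fstep [Node a S] b F -> b = a /\ Permutation F S.
Proof.
  intros (T & F0 & H1 & H2). apply Permutation_length_1_inv in H1.
  injection H1 as -> -> ->. now rewrite app_nil_r in H2.
Qed.

Lemma erase_fstep_inv f P k F :
  fstep (erase f P) k F ->
  exists mu P', step P mu P' /\ kept f mu k /\ Permutation F (erase (elift mu f) P').
Proof.
  revert f F. induction P as [|m P IH|m n P IH|P IHP Q IHQ|P IH]; intros f F H; simpl in H.
  - apply fstep_size in H. discriminate.
  - destruct (f true m) eqn:E; [|apply fstep_size in H; discriminate].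
    apply fstep_single_inv in H as [-> H]. exists (LInp m), P. repeat split; auto. constructor.
  - destruct (f false m) eqn:E; [|apply fstep_size in H; discriminate].
    apply fstep_single_inv in H as [-> H]. exists (LOut m n), P. repeat split; auto. constructor.
  - apply fstep_app_inv in H as [(F' & H & HP)|(F' & H & HP)].
    + apply IHP in H as (mu & P' & Hs & Hk & HF). eexists mu, _. split; [apply step_par_l, Hs|].
      split; [exact Hk|]. simpl. now rewrite erase_weaken_by, HP, HF.
    + apply IHQ in H as (mu & P' & Hs & Hk & HF). eexists mu, _. split; [apply step_par_r, Hs|].
      split; [exact Hk|]. simpl. now rewrite erase_weaken_by, HP, HF.
  - apply IH in H as (mu & P' & Hs & Hk & HF).
    (* The index 0 is not kept as a subject, so the label mentions the restricted name as the object
       of a free output or not at all. *)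
    assert ((exists b, mu = LOut (S b) 0) \/ exists nu, mu = subst_label S nu) as [(b & ->)|(nu & ->)].
    { destruct mu as [[|a]|[|a] [|b]|[|a]|]; try (now destruct Hk).
      - right. now exists (LInp a).
      - left. now exists a.
      - right. now exists (LOut a b).
      - right. now exists (LBOut a). }
    + exists (LBOut b), P'. split; [now apply step_open|]. split; [exact Hk|exact HF].
    + eexists nu, _. split; [apply step_new, Hs|]. split; [exact (proj1 (kept_subst_label _ S nu k) Hk)|].
      rewrite HF. simpl. apply eq_ind with (x := erase (elift (subst_label S nu) (elift (LBOut 0) f)) P');
        [reflexivity|erase_by_cases].
Qed.

(** The moves of the erasure are exactly the kept transitions: a prefix that is not kept disappears
    with its whole continuation, and silent steps have no counterpart. *)
Lemma erase_fbisim f P Q : ground_bisimilar P Q -> fbisim (erase f P) (erase f Q).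
Proof.
  intros H.
  exists (fun F G => exists f P Q, ground_bisimilar P Q /\
    Permutation F (erase f P) /\ Permutation G (erase f Q)).
  split; [split|exists f, P, Q; auto].
  - intros F G (g & P0 & Q0 & ? & ? & ?). exists g, Q0, P0. auto using ground_bisimilar_sym.
  - intros F G k F' (g & P0 & Q0 & H0 & HF & HG) Hs.
    apply (fstep_perm _ _ _ F' k HF (Permutation_refl _)) in Hs.
    apply erase_fstep_inv in Hs as (mu & P' & Hs & Hk & HF').
    destruct (ground_bisimilar_step _ _ _ _ H0 Hs) as (Q' & HQ & HR).
    exists (erase (elift mu g) Q'). split.
    + eapply fstep_perm; [symmetry; exact HG|reflexivity|]. now apply step_erase.
    + exists (elift mu g), P', Q'. auto.
Qed.

(** * Two consecutive actions: parallel or nested *)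

Definition nested (f : bool -> name -> bool) P mu nu W (k l : bool) : Prop :=
  exists T T' F, Permutation (erase f P) (Node k T :: F) /\ fstep T l T' /\
    Permutation (erase (elift nu (elift mu f)) W) (T' ++ F).

(** When the process is itself the prefix that acts first, the second action comes from its
    continuation: the two are nested. At a parallel composition, the second action comes from the
    same component, by induction, or from the other one, and then the two are concurrent. The
    weakened label [subst_label (wk mu) nu] cannot mention the name bound by [mu]. *)
Lemma steps_conc_or_nested f P mu nu P1 P2 k l :
  step P mu P1 -> step P1 (subst_label (wk mu) nu) P2 -> kept f mu k -> kept f nu l ->
  conc P mu nu P2 \/ nested f P mu nu P2 k l.
Proof.
  intros H. revert f nu P2 k l.
  induction H; intros f nu P2 k l H2 Hk Hl; simpl in Hk; try easy.
  - right. destruct Hk as [-> Hk]. exists (erase (elift (LInp a) f) P), (erase (elift nu (elift (LInp a) f)) P2), [].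
    rewrite app_nil_r. simpl. rewrite Hk. repeat split; auto.
    rewrite <- (elift_subst_label (wk (LInp a)) nu).
    eapply step_erase; [exact H2|]. now apply kept_subst_label.
  - right. destruct Hk as [-> Hk]. exists (erase f P), (erase (elift nu (elift (LOut a b) f)) P2), [].
    rewrite app_nil_r. simpl. rewrite Hk. repeat split; auto.
    rewrite <- (elift_subst_label (wk (LOut a b)) nu).
    eapply step_erase; [exact H2|]. now apply kept_subst_label.
  - destruct (IHstep (elift (LBOut 0) f) (subst_label S nu) P2 k l) as [HW|HW].
    + eapply step_eq; [exact H2| |reflexivity]. unfold wk; simpl. now destruct nu.
    + exact Hk.
    + now apply kept_subst_label.
    + left. now apply conc_open_fst.
    + right. destruct HW as (T & T' & F & HP & HT & HF). exists T, T', F. split; [exact HP|].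
      split; [exact HT|]. rewrite <- HF.
      apply eq_ind with (x := erase (elift nu (elift (LBOut a) f)) P2); [reflexivity|erase_by_cases].
  (* A communication between the components would make [nu] silent, which [kept] excludes. *)
  - inversion H2; subst; clear H2; try (destruct nu; (discriminate || now destruct Hl)).
    + match goal with H : step P' _ _ |- _ => destruct (IHstep f nu _ k l H Hk Hl) as [HW|HW] end.
      * left. eapply conc_eq; [apply conc_par_l, HW|]. rename_by_cases.
      * right. destruct HW as (T & T' & F & HP & HT & HF). exists T, T', (F ++ erase f Q).
        simpl. rewrite HP. split; [reflexivity|]. split; [exact HT|].
        rewrite HF, <- app_assoc, <- elift_subst_label with (s := wk mu), !erase_weaken_by. reflexivity.
    + match goal with H : step (weaken_by mu Q) _ _ |- _ => rename H into HQ end.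
      rewrite weaken_byE in HQ. apply step_subst_injective_inv in HQ as (nu0 & Q0 & HQ & E & ->).
      * assert (nu0 = nu) as ->.
        { unfold wk in E. destruct (binds mu), nu, nu0; simpl in E; congruence. }
        left. eapply conc_eq; [eapply conc_lr; eassumption|]. rename_by_cases.
      * unfold wk. destruct (binds mu); congruence.
  - inversion H2; subst; clear H2; try (destruct nu; (discriminate || now destruct Hl)).
    + match goal with H : step (weaken_by mu P) _ _ |- _ => rename H into HQ end.
      rewrite weaken_byE in HQ. apply step_subst_injective_inv in HQ as (nu0 & P0 & HQ & E & ->).
      * assert (nu0 = nu) as ->.
        { unfold wk in E. destruct (binds mu), nu, nu0; simpl in E; congruence. }
        left. eapply conc_eq; [eapply conc_rl; eassumption|]. rename_by_cases.
      * unfold wk. destruct (binds mu); congruence.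
    + match goal with H : step Q' _ _ |- _ => destruct (IHstep f nu _ k l H Hk Hl) as [HW|HW] end.
      * left. eapply conc_eq; [apply conc_par_r, HW|]. rename_by_cases.
      * right. destruct HW as (T & T' & F & HP & HT & HF). exists T, T', (F ++ erase f P).
        simpl. rewrite HP. split; [apply Permutation_app_comm|]. split; [exact HT|].
        rewrite HF, <- elift_subst_label with (s := wk mu), !erase_weaken_by, Permutation_app_comm, <- app_assoc.
        reflexivity.
  - rewrite exchange_byE in H2.
    assert (Hex : forall n, exch mu (exch mu n) = n).
    { intros n. unfold exch. destruct (binds mu); [apply swap_swap|reflexivity]. }
    inversion H2; subst; clear H2;
      match goal with H : step (subst _ P') _ _ |- _ => rename H into H2 end;
      apply (step_subst_involutive _ _ _ _ Hex) in H2.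
    + destruct nu as [| |b|]; try discriminate.
      match goal with H : LBOut _ = _ |- _ => injection H as -> end.
      match type of H2 with step _ _ ?X =>
        destruct (IHstep (elift (LBOut 0) f) (LOut (S b) 0) X k l) as [HW|HW] end.
      * eapply step_eq; [exact H2| |reflexivity].
        unfold wk, exch. rewrite binds_subst. simpl. destruct (binds mu); reflexivity.
      * now apply kept_subst_label.
      * exact Hl.
      * left. eapply conc_eq; [apply conc_open_snd, HW|]. rename_by_cases.
      * right. destruct HW as (T & T' & F & HP & HT & HF). exists T, T', F. split; [exact HP|].
        split; [exact HT|]. rewrite <- HF.
        eapply eq_ind; [reflexivity|erase_by_cases].
    + match type of H2 with step _ _ ?X =>
        destruct (IHstep (elift (LBOut 0) f) (subst_label S nu) X k l) as [HW|HW] end.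
      * eapply step_eq; [exact H2| |reflexivity].
        rewrite !subst_label_comp. unfold wk, exch. rewrite binds_subst.
        destruct nu, (binds mu); reflexivity.
      * now apply kept_subst_label.
      * now apply kept_subst_label.
      * left. eapply conc_eq; [apply conc_new, HW|]. rename_by_cases.
      * right. destruct HW as (T & T' & F & HP & HT & HF). exists T, T', F. split; [exact HP|].
        split; [exact HT|]. rewrite <- HF. simpl.
        eapply eq_ind; [reflexivity|erase_by_cases].
Qed.

(** * Closure under substitution *)

Lemma conc_ground_bisimilar P Q o a b W :
  ground_bisimilar P Q -> conc P o (LInp a) W -> is_output o b -> a <> b ->
  exists W', conc Q o (LInp a) W' /\ ground_bisimilar W W'.
Proof.
  intros H HW Ho Hab.
  (* The erasure keeps the inputs on [a], labelled [true], and the outputs on [b], labelled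
     [false]. *)
  set (f := fun (k : bool) (n : name) => if k then n =? a else n =? b).
  assert (Hka : kept f (LInp a) true) by (simpl; rewrite Nat.eqb_refl; auto).
  assert (Hko : kept f o false).
  { destruct o; simpl in *; subst; try easy; rewrite Nat.eqb_refl; auto. }
  pose proof (conc_sym _ _ _ _ HW) as HW'.
  destruct (conc_steps _ _ _ _ HW) as (P1 & HP1 & HP2).
  destruct (ground_bisimilar_step _ _ _ _ H HP1) as (Q1 & HQ1 & H1).
  destruct (ground_bisimilar_step _ _ _ _ H1 HP2) as (Q2 & HQ2 & H2).
  destruct (steps_conc_or_nested f _ _ _ _ _ _ _ HQ1 HQ2 Hko Hka) as [HQ|HQ]; [eauto|].
  destruct (conc_steps _ _ _ _ HW') as (P1' & HP1' & HP2').
  destruct (ground_bisimilar_step _ _ _ _ H HP1') as (Q1' & HQ1' & H1').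
  destruct (ground_bisimilar_step _ _ _ _ H1' HP2') as (Q2' & HQ2' & H2').
  destruct (steps_conc_or_nested f _ _ _ _ _ _ _ HQ1' HQ2' Hka Hko) as [HQ'|HQ'].
  (* The run with the input first is parallel. Reversing it exchanges the names bound by the two
     actions, and renaming the bisimilarity by the same involution restores [W]. *)
  - apply conc_sym in HQ'. eexists. split; [exact HQ'|].
    apply (ground_bisimilar_injective _ _ (exch2 (LInp a) o)) in H2'.
    + rewrite subst_comp, subst_id in H2'; [exact H2'|].
      unfold exch2, exch; simpl. destruct (binds o); [apply swap_swap|reflexivity].
    + unfold exch2. apply exch_injective.
  (* Both runs of [Q] are nested. Their erased residuals are bisimilar, since both match the
     residual [W] of [P], up to the exchange of bound names. *)
  - exfalso.
    destruct HQ as (T & T' & F & HF & HT & HF'), HQ' as (U & U' & G & HG & HU & HG').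
    eapply (not_desynchronised_both_ways false true); [discriminate|exact HF|exact HT|exact HG|exact HU|].
    eapply fbisim_trans; [apply fbisim_perm; symmetry; exact HF'|].
    eapply fbisim_trans; [|apply fbisim_perm; exact HG'].
    eapply fbisim_trans; [apply erase_fbisim, ground_bisimilar_sym, H2|].
    apply (erase_fbisim (elift o (elift (LInp a) f))) in H2'.
    eapply eq_ind with (P := fun F => fbisim F _); [exact H2'|]. erase_by_cases.
Qed.

(** Closure under restriction is required because fusing an input with a bound output leaves a
    restriction over the substituted residual. *)
Inductive subst_closure : proc -> proc -> Prop :=
| closure_subst : forall P Q s,
    ground_bisimilar P Q -> subst_closure (subst s P) (subst s Q)
| closure_new : forall P Q, subst_closure P Q -> subst_closure (New P) (New Q).

Lemma subst_closure_sym P Q : subst_closure P Q -> subst_closure Q P.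
Proof. induction 1; constructor; auto using ground_bisimilar_sym. Qed.

Lemma subst_closure_subst P Q s : subst_closure P Q -> subst_closure (subst s P) (subst s Q).
Proof.
  intros H. revert s. induction H; intros s'; simpl.
  - rewrite !subst_comp. now constructor.
  - constructor. apply IHsubst_closure.
Qed.

(** Bisimilarity on both sides absorbs the position of that restriction, which may lie deep in the
    residual. *)
Definition subst_closure_upto (P Q : proc) : Prop :=
  exists P1 Q1, ground_bisimilar P P1 /\ subst_closure P1 Q1 /\ ground_bisimilar Q1 Q.

Lemma subst_closure_upto_intro P Q : subst_closure P Q -> subst_closure_upto P Q.
Proof. exists P, Q. auto using ground_bisimilar_refl. Qed.

(** Lifted transitions are answered before the substitution is applied. A new silent step comes from
    two concurrent actions, which [conc_ground_bisimilar] transfers to the other process, where [s]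
    merges the subjects as well. *)
Lemma subst_closure_step P Q mu P' :
  subst_closure P Q -> step P mu P' -> exists Q', step Q mu Q' /\ subst_closure_upto P' Q'.
Proof.
  intros H. revert mu P'. induction H as [P Q s H|P Q H IH]; intros mu P' Hs.
  - apply step_subst_inv in Hs as [(mu0 & P0 & HP & -> & ->)|(-> & a & b & o & W & Hab & Es & Ho & HW & HV)].
    + destruct (ground_bisimilar_step _ _ _ _ H HP) as (Q0 & HQ & H0).
      exists (subst (upb mu0 s) Q0). split; [now apply step_subst|].
      now apply subst_closure_upto_intro, closure_subst.
    + destruct (conc_ground_bisimilar _ _ _ _ _ _ H HW Ho Hab) as (W' & HW' & HWW).
      destruct (conc_step_tau _ _ _ _ _ _ HW' Ho Es) as (V & HQ & HV').
      exists V. split; [exact HQ|].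
      destruct o as [|c d|c|]; simpl in HV, HV'; try easy; rewrite subst_comp in HV, HV'.
      * subst. now apply subst_closure_upto_intro, closure_subst.
      (* Once the restriction is on top, its bodies are instances of the bisimilar [W] and [W']
         under one substitution. *)
      * eexists _, _. split; [apply extr_ground_bisimilar, HV|].
        split; [|apply ground_bisimilar_sym, extr_ground_bisimilar, HV'].
        now apply closure_new, closure_subst.
  - inversion Hs; subst; clear Hs;
      match goal with H : step P _ _ |- _ => apply IH in H as (Q' & HQ & P1 & Q1 & HP1 & HPQ & HQ1) end.
    + exists Q'. split; [now apply step_open|]. exists P1, Q1. auto.
    + eexists. split; [apply step_new, HQ|]. rewrite !exchange_byE.
      exists (New (subst (exch mu) P1)), (New (subst (exch mu) Q1)). split; [|split].
      * apply ground_bisimilar_new, ground_bisimilar_injective; [apply exch_injective|exact HP1].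
      * apply closure_new, subst_closure_subst, HPQ.
      * apply ground_bisimilar_new, ground_bisimilar_injective; [apply exch_injective|exact HQ1].
Qed.

Theorem theorem5p8 (P Q : proc) (s : name -> name) :
  ground_bisimilar P Q -> ground_bisimilar (subst s P) (subst s Q).
Proof.
  (* The surrounding bisimilarities are played before and after the step of the closure, and
     recombine by transitivity. *)
  intros H. exists subst_closure_upto. split; [split|].
  - intros A B (A1 & B1 & HA & HAB & HB).
    exists B1, A1. auto using ground_bisimilar_sym, subst_closure_sym.
  - intros A B mu A' (A1 & B1 & HA & HAB & HB) Hs.
    destruct (ground_bisimilar_step _ _ _ _ HA Hs) as (A1' & Hs1 & HA').
    destruct (subst_closure_step _ _ _ _ HAB Hs1) as (B1' & Hs2 & A2 & B2 & HA2 & HAB2 & HB2).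
    destruct (ground_bisimilar_step _ _ _ _ HB Hs2) as (B' & Hs3 & HB').
    exists B'. split; [exact Hs3|]. exists A2, B2.
    split; [|split]; [|exact HAB2|]; eapply ground_bisimilar_trans; eassumption.
  - now apply subst_closure_upto_intro, closure_subst.
Qed.
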